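(* Let $n\ge 2$ be an integer, let $K$ be a field containing $n$ distinct $n$-th roots of $1$, let $R=K[x,y,z]$, and let $I=(x(y^n-z^n),\,y(z^n-x^n),\,z(x^n-y^n))\subset R$. Then the symbolic Rees algebra $\mathcal{R}_s(I)=\bigoplus_{i\ge 0} I^{(i)}t^i\subseteq R[t]$ is a Noetherian ring.
   Context: The ideal $I$ is called a Fermat ideal (the ideal of a Fermat configuration of points); it is the radical ideal of a set of $n^2+3$ points in $\mathbf{P}^2$. For $m\ge 0$, $I^{(m)}$ denotes the $m$-th symbolic power, $I^{(m)}=\bigcap_{\mathfrak p\in \mathrm{Ass}(R/I)}(I^mR_{\mathfrak p}\cap R)$, with $I^{(0)}=R$; for this ideal it is equivalently $I^{(m)}=(x^n-y^n,y^n-z^n)^m\cap(x,y)^m\cap(y,z)^m\cap(z,x)^m$. *)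

(* Defs.v *)
From HB Require Import structures.
From mathcomp Require Import all_boot all_order all_algebra.
From mathcomp Require Import boolp classical_sets.
From mathcomp Require Import mpoly.

Set Implicit Arguments.
Unset Strict Implicit.
Unset Printing Implicit Defensive.

Import GRing.Theory.

Local Open Scope classical_set_scope.
Local Open Scope ring_scope.

Notation tofrac := (@FracField.tofrac _).

(* Ideals are Prop-valued sets; the unit ideal is allowed, contrary to the
   [idealr_closed] predicates of ring_quotient.v. *)
Definition is_ideal (A : comNzRingType) (J : set A) : Prop :=
  [/\ J 0, (forall f g, J f -> J g -> J (f + g))
    & (forall a f, J f -> J (a * f))].

Definition is_prime_ideal (A : comNzRingType) (p : set A) : Prop :=
  [/\ is_ideal p, ~ p 1 & forall a b, p (a * b) -> p a \/ p b].

(* The finite sums of terms a * g with a : A and g in S, encoded by the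
   sequence of the pairs (a, g). *)
Definition ideal_span (A : comNzRingType) (S : set A) : set A :=
  [set f | exists2 s : seq (A * A),
     (forall c, c \in s -> S c.2) & f = \sum_(c <- s) c.1 * c.2].

Definition noetherian (A : comNzRingType) : Prop :=
  forall J : set A, is_ideal J ->
    exists s : seq A, J = ideal_span [set` s].

Definition ideal_mul (A : comNzRingType) (I J : set A) : set A :=
  ideal_span [set h | exists a b, [/\ I a, J b & h = a * b]].

Definition ideal_exp (A : comNzRingType) (I : set A) (m : nat) : set A :=
  iter m (ideal_mul I) setT.

(* Ass(A / I): the prime ideals which are the annihilator of some element
   f + I of A / I. *)
Definition associated_primes (A : comNzRingType) (I : set A) : set (set A) :=
  [set p | is_prime_ideal p /\ exists f, p = [set a | I (a * f)]].

(* For a domain R and a prime p, the localization R_p inside Frac(R). *)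
Definition local_at (R : idomainType) (p : set R) : set {fraction R} :=
  [set u | exists a s, ~ p s /\ u = tofrac a / tofrac s].

(* J R_p, as a subset of Frac(R). *)
Definition local_ext (R : idomainType) (p J : set R) : set {fraction R} :=
  [set u | exists2 s : seq ({fraction R} * R),
     (forall c, c \in s -> local_at p c.1 /\ J c.2)
     & u = \sum_(c <- s) c.1 * tofrac c.2].

Definition symbolic_power (R : idomainType) (I : set R) (m : nat) : set R :=
  \bigcap_(p in associated_primes I) (tofrac @^-1` local_ext p (ideal_exp I m)).

Definition symbolic_rees_pred (R : idomainType) (I : set R) :
  {pred {poly R}} := fun P => `[< forall i, symbolic_power I i P`_i >].

Lemma ideal_spanM (A : comNzRingType) (S : set A) a f :
  ideal_span S f -> ideal_span S (a * f).
Proof.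
case=> s Hs ->; exists [seq (a * c.1, c.2) | c <- s].
  by move=> c /mapP[d ds ->]; apply: (Hs d).
by rewrite mulr_sumr big_map; apply: eq_bigr => c _; rewrite /= mulrA.
Qed.

Lemma ideal_span0 (A : comNzRingType) (S : set A) : ideal_span S 0.
Proof. by exists [::] => //; rewrite big_nil. Qed.

Lemma ideal_spanD (A : comNzRingType) (S : set A) f g :
  ideal_span S f -> ideal_span S g -> ideal_span S (f + g).
Proof.
case=> s Hs -> [t Ht ->]; exists (s ++ t); last by rewrite big_cat.
by move=> c; rewrite mem_cat => /orP[/Hs|/Ht].
Qed.

Lemma ideal_span_sub (A : comNzRingType) (S : set A) f : S f -> ideal_span S f.
Proof.
move=> Sf; exists [:: (1, f)]; last by rewrite big_seq1 mul1r.
by move=> c; rewrite inE => /eqP ->.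
Qed.

Lemma ideal_exp_ideal (A : comNzRingType) (I : set A) m :
  is_ideal (ideal_exp I m).
Proof.
case: m => [|m]; first by split.
split; [exact: ideal_span0 | exact: ideal_spanD |].
exact: ideal_spanM.
Qed.

Lemma ideal_expD (A : comNzRingType) (I : set A) i j a b :
  ideal_exp I i a -> ideal_exp I j b -> ideal_exp I (i + j) (a * b).
Proof.
elim: i a => [|i IHi] a.
  by move=> _ Hb; case: (ideal_exp_ideal I j) => _ _; exact.
case=> s Hs -> Hb; rewrite mulr_suml.
rewrite big_seq; apply: big_ind => [||c cs].
- exact: ideal_span0.
- exact: ideal_spanD.
- have [x [y [Ix Hy Ec]]] := Hs _ cs.
  rewrite -mulrA; apply: ideal_spanM; apply: ideal_span_sub.
  by exists x, (y * b); split; [| exact: IHi | rewrite Ec mulrA].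
Qed.

Lemma symbolic_powerM (R : idomainType) (I : set R) i j a b :
  symbolic_power I i a -> symbolic_power I j b ->
  symbolic_power I (i + j) (a * b).
Proof.
move=> Ha Hb p Hp; have [s Hs Ea] := Ha p Hp; have [t Ht Eb] := Hb p Hp.
have [[_ _ prp] _] := Hp.
exists [seq (c.1 * d.1, c.2 * d.2) | c <- s, d <- t].
  move=> e /allpairsP[[c d] /= [cs dt ->]] /=.
  have [[x [y [Hy ->]]] Hc] := Hs _ cs; have [[z [w [Hw ->]]] Hd] := Ht _ dt.
  split; last exact: ideal_expD.
  exists (x * z), (y * w); split; first by case/prp.
  by rewrite !rmorphM /= invfM mulrACA.
rewrite rmorphM /= Ea Eb big_allpairs_dep mulr_suml; apply: eq_bigr => c _.
by rewrite mulr_sumr; apply: eq_bigr => d _ /=; rewrite rmorphM /= mulrACA.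
Qed.

Lemma symbolic_powerD (R : idomainType) (I : set R) i a b :
  symbolic_power I i a -> symbolic_power I i b -> symbolic_power I i (a + b).
Proof.
move=> Ha Hb p Hp; have [s Hs Ea] := Ha p Hp; have [t Ht Eb] := Hb p Hp.
exists (s ++ t); last by rewrite rmorphD /= Ea Eb big_cat.
by move=> c; rewrite mem_cat => /orP[/Hs|/Ht].
Qed.

Lemma symbolic_power0E (R : idomainType) (I : set R) :
  symbolic_power I 0 = setT.
Proof.
apply/seteqP; split=> // a _ p [[_ p1 _] _].
exists [:: (1, a)]; last by rewrite big_seq1 mul1r.
move=> c; rewrite inE => /eqP -> /=; split=> //.
by exists 1, 1; rewrite !rmorph1 divr1.
Qed.

Lemma symbolic_power_ideal (R : idomainType) (I : set R) i :
  is_ideal (symbolic_power I i).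
Proof.
split=> [p _||a f Hf]; [|exact: symbolic_powerD|].
  by exists [::] => //; rewrite big_nil rmorph0.
by rewrite -[i]add0n; apply: symbolic_powerM; rewrite ?symbolic_power0E.
Qed.

Lemma symbolic_rees_subring (R : idomainType) (I : set R) :
  subring_closed (symbolic_rees_pred I).
Proof.
have H0 i := symbolic_power_ideal I i.
split=> [|P Q /asboolP HP /asboolP HQ|P Q /asboolP HP /asboolP HQ];
  apply/asboolP => i.
- rewrite coef1; case: i => [|i]; first by rewrite symbolic_power0E.
  by case: (H0 i.+1).
- case: (H0 i) => _ HD HM.
  by rewrite coefB -mulN1r; apply: HD => //; apply: HM.
- rewrite coefM; case: (H0 i) => H1 HD _.
  apply: big_ind => // k _.
  by rewrite -{1}(subnKC (ltn_ord k : (k <= i)%N)); apply: symbolic_powerM.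
Qed.

HB.instance Definition _ (R : idomainType) (I : set R) :=
  GRing.isSubringClosed.Build {poly R} (symbolic_rees_pred I)
    (@symbolic_rees_subring R I).

(* The symbolic Rees algebra of I, as a subring of R[t] = {poly R}. *)
Record symbolic_rees (R : idomainType) (I : set R) := SymbolicRees {
  symbolic_rees_val :> {poly R};
  _ : symbolic_rees_val \in symbolic_rees_pred I
}.

HB.instance Definition _ (R : idomainType) (I : set R) :=
  [isSub for @symbolic_rees_val R I].
HB.instance Definition _ (R : idomainType) (I : set R) :=
  [Choice of symbolic_rees I by <:].
HB.instance Definition _ (R : idomainType) (I : set R) :=
  [SubChoice_isSubComNzRing of symbolic_rees I by <:].

Definition fermat_ideal (K : fieldType) (n : nat) : set {mpoly K[3]} :=
  let x : {mpoly K[3]} := 'X_(inord 0) in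
  let y : {mpoly K[3]} := 'X_(inord 1) in
  let z : {mpoly K[3]} := 'X_(inord 2) in
  ideal_span [set` [:: x * (y ^+ n - z ^+ n); y * (z ^+ n - x ^+ n);
                       z * (x ^+ n - y ^+ n)]].
Arguments fermat_ideal : clear implicits.

(* Main.v *)
(* Put X = x^n, Y = y^n, Z = z^n, f1 = Y - Z, f2 = Z - X, f3 = X - Y. The m-th
   symbolic power consists of the F vanishing to order m at the n^2 + 3 points,
   and it is spanned by the products x^e1 y^e2 z^e3 f1^a f2^b f3^c which do so
   for the evident reason: a + b + c >= m, e2 + e3 + n a >= m, e1 + e3 + n b >= m
   and e1 + e2 + n c >= m. Indeed, after splitting F along the exponents of x
   and y modulo n and the degree, one is left with forms in X, Y, Z vanishing at
   (1 : 1 : 1) and at the coordinate points, hence with the Cox ring of the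
   projective plane blown up at four points. There the order at (1 : 1 : 1) is
   raised one step at a time: modulo higher order, the relations
   f1 + f2 + f3 = 0 and X f1 + Y f2 + Z f3 = 0 reduce to products with linearly
   independent leading forms.
   The exponents (e1, e2, e3, a, b, c, m) allowed above become, with slack
   variables for the four inequalities, the degree 0 monomials of a Z^4-graded
   polynomial ring. Its degree 0 part is a direct summand, hence Noetherian, and
   it maps onto the symbolic Rees algebra. *)

Require Import Defs.
From mathcomp Require Import all_boot all_order all_algebra.
From mathcomp Require Import boolp classical_sets.
From mathcomp Require Import mpoly.
From mathcomp Require Import cyclic ring zify.

Set Implicit Arguments.
Unset Strict Implicit.
Unset Printing Implicit Defensive.

Import GRing.Theory.

Local Open Scope classical_set_scope.
Local Open Scope ring_scope.

(** * Noetherian rings *)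

Lemma ideal_span_ideal (A : comNzRingType) (S : set A) :
  is_ideal (ideal_span S).
Proof.
by split; [exact: ideal_span0 | exact: ideal_spanD | exact: ideal_spanM].
Qed.

Lemma ideal_sum (A : comNzRingType) (J : set A) (I : eqType) (s : seq I)
    (P : pred I) (F : I -> A) :
  is_ideal J -> (forall i, i \in s -> P i -> J (F i)) ->
  J (\sum_(i <- s | P i) F i).
Proof.
case=> J0 JD _ JF; rewrite big_seq_cond; apply: big_ind => //.
by move=> i /andP[si Pi]; apply: JF.
Qed.

Lemma ideal_span_min (A : comNzRingType) (S J : set A) :
  is_ideal J -> S `<=` J -> ideal_span S `<=` J.
Proof.
move=> idJ SJ f [s Hs ->]; apply: ideal_sum => // c cs _.
by case: idJ => _ _; apply; apply/SJ/Hs.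
Qed.

Lemma ideal_span_mono (A : comNzRingType) (S T : set A) :
  S `<=` T -> ideal_span S `<=` ideal_span T.
Proof.
move=> ST; apply: ideal_span_min; first exact: ideal_span_ideal.
by move=> x /ST; apply: ideal_span_sub.
Qed.

(** Finitely many generators of the ideal spanned by [g @]
    T[each involve finitely many elements of]g @[T]. As [g] is any function, it may be a leading
    coefficient, and the chosen preimages stay in [T]. *)
Lemma noetherian_finite_image (A B : comNzRingType) (g : B -> A) (T : set B) :
  noetherian A ->
  exists2 s : seq B, (forall b, b \in s -> T b) &
    forall b, T b -> ideal_span [set` map g s] (g b).
Proof.
move=> noA; have [t Et] := noA _ (ideal_span_ideal (g @` T)).
have Ht x : x \in t -> ideal_span (g @` T) x.
  by move=> xt; rewrite Et; apply: ideal_span_sub.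
have [s sT Hs] : exists2 s : seq B, (forall b, b \in s -> T b) &
    forall x, x \in t -> ideal_span [set` map g s] x.
  elim: t Ht {Et} => [|x t IHt] Ht; first by exists [::].
  have [|s sT Hs] := IHt; first by move=> y yt; apply: Ht; rewrite inE yt orbT.
  have [r Hr Ex] := Ht x (mem_head _ _).
  have [s' s'T Hs'] : exists2 s' : seq B, (forall b, b \in s' -> T b) &
      forall c, c \in r -> c.2 \in map g s'.
    elim: r Hr {Ex} => [|c r IHr] Hr; first by exists [::].
    have [|s' s'T Hs'] := IHr; first by move=> d dr; apply: Hr; rewrite inE dr orbT.
    have [b Tb gb] := Hr c (mem_head _ _); exists (b :: s').
      by move=> d; rewrite inE => /orP[/eqP -> //|/s'T].
    move=> d; rewrite !inE => /orP[/eqP ->|/Hs' ->]; last by rewrite orbT.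
    by rewrite -gb eqxx.
  exists (s ++ s'); first by move=> b; rewrite mem_cat => /orP[/sT|/s'T].
  move=> y; rewrite inE => /orP[/eqP ->|yt].
    by exists r => // c cr; rewrite /= map_cat mem_cat Hs' ?orbT.
  apply: ideal_span_mono (Hs _ yt) => z /=.
  by rewrite map_cat mem_cat => ->.
exists s => // b Tb; apply: (@ideal_span_min _ [set` t]).
- exact: ideal_span_ideal.
- exact: Hs.
- by rewrite -Et; apply: ideal_span_sub; exists b.
Qed.

Lemma noetherianP (A : comNzRingType) :
  (forall J : set A, is_ideal J -> exists2 s : seq A,
     (forall x, x \in s -> J x) & J `<=` ideal_span [set` s]) ->
  noetherian A.
Proof.
move=> H J idJ; have [s sJ Js] := H J idJ; exists s.
by apply/seteqP; split=> //; apply: ideal_span_min.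
Qed.

Lemma noetherian_field (K : fieldType) : noetherian K.
Proof.
apply: noetherianP => J [J0 _ JM].
have [[c [Jc c0]]|H] := pselect (exists c, J c /\ c != 0).
  exists [:: c]; first by move=> x; rewrite inE => /eqP ->.
  move=> x _; rewrite -[x](divfK c0); apply: ideal_spanM.
  by apply: ideal_span_sub; rewrite /= inE.
exists [::] => // x Jx; have [->|x0] := eqVneq x 0; first exact: ideal_span0.
by case: H; exists x.
Qed.

(** The multipliers are constants, so combining the polynomials does not raise the degree. *)
Lemma coef_seq_lift (A : comNzRingType) (d : nat) (G : seq {poly A}) a :
  (forall p, p \in G -> (size p <= d.+1)%N) ->
  ideal_span [set` [seq p`_d | p : {poly A} <- G]] a ->
  exists q, [/\ ideal_span [set` G] q, (size q <= d.+1)%N & q`_d = a].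
Proof.
move=> sG; have [G0 GD GM] := ideal_span_ideal [set` G].
apply: (ideal_span_min (J := [set a | exists q,
  [/\ ideal_span [set` G] q, (size q <= d.+1)%N & q`_d = a]])).
  split.
  - by exists 0; rewrite size_poly0 coef0.
  - move=> _ _ [p [Gp sp <-]] [q [Gq sq <-]]; exists (p + q).
    split; [exact: GD | | by rewrite coefD].
    by rewrite (leq_trans (size_polyD _ _)) // geq_max sp.
  - move=> c _ [p [Gp sp <-]]; exists (c *: p).
    split; [by rewrite -mul_polyC; apply: GM | | by rewrite coefZ].
    exact: leq_trans (size_scale_leq _ _) sp.
move=> _ /mapP[p pG ->]; exists p; split=> //; last exact: sG.
exact: ideal_span_sub.
Qed.

(** Hilbert's basis theorem. *)
Lemma noetherian_poly (A : comNzRingType) : noetherian A -> noetherian {poly A}.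
Proof.
move=> noA; apply: noetherianP => J [J0 JD JM].
(* It suffices to match the leading term of each element of [J] by a combination of [G] of no larger
   degree: subtracting it lowers the size. *)
suff [G GJ HG] : exists2 G : seq {poly A}, (forall p, p \in G -> J p) &
    forall d p, J p -> size p = d.+1 -> exists q,
      [/\ ideal_span [set` G] q, (size q <= d.+1)%N & q`_d = p`_d].
  exists G => // p; move: {-1}(size p) (leqnn (size p)) => N.
  elim: N p => [|N IHN] p sp Jp.
    by move: sp; rewrite leqn0 size_poly_eq0 => /eqP ->; apply: ideal_span0.
  have [sp'|sp'] := leqP (size p) N; first exact: IHN.
  have {}sp : size p = N.+1 by apply/eqP; rewrite eqn_leq sp sp'.
  have [q [Gq sq Eq]] := HG _ _ Jp sp.
  have Jq : J q by apply: ideal_span_min Gq => //.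
  rewrite -(subrK q p); apply: ideal_spanD => //.
  apply: IHN; last by apply: JD => //; rewrite -mulN1r; apply: JM.
  apply/leq_sizeP => j; rewrite leq_eqVlt => /orP[/eqP <-|Nj].
    by rewrite coefB Eq subrr.
  rewrite coefB !nth_default ?subrr //; last by rewrite sp.
  exact: leq_trans sq Nj.
(* Generators for the leading coefficients serve in all degrees from [N] on; the finitely many
   degrees below [N] get generators of their own. *)
have [G0 G0J HG0] := noetherian_finite_image (@lead_coef A) J noA.
pose N := \max_(p <- G0) size p.
have low M : exists2 G : seq {poly A}, (forall p, p \in G -> J p) &
    forall d p, (d < M)%N -> J p -> size p = d.+1 -> exists q,
      [/\ ideal_span [set` G] q, (size q <= d.+1)%N & q`_d = p`_d].
  elim: M => [|M [G GJ HG]]; first by exists [::].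
  have [G' G'J HG'] := noetherian_finite_image (fun p : {poly A} => p`_M)
    [set p | J p /\ (size p <= M.+1)%N] noA.
  exists (G ++ G'); first by move=> p; rewrite mem_cat => /orP[/GJ|/G'J[]].
  have GG' : ideal_span [set` G] `<=` ideal_span [set` G ++ G'].
    by apply: ideal_span_mono => p /=; rewrite mem_cat => ->.
  have G'G : ideal_span [set` G'] `<=` ideal_span [set` G ++ G'].
    by apply: ideal_span_mono => p /=; rewrite mem_cat orbC => ->.
  move=> d p; rewrite ltnS leq_eqVlt => /orP[/eqP ->|dM] Jp sp.
    have [||q [Gq sq Eq]] := @coef_seq_lift A M G' p`_M.
    - by move=> q /G'J[].
    - by apply: HG'; rewrite /= sp.
    - by exists q; split=> //; apply: G'G.
  by have [q [Gq sq Eq]] := HG d p dM Jp sp; exists q; split=> //; apply: GG'.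
have [G1 G1J HG1] := low N.
exists (G0 ++ G1); first by move=> p; rewrite mem_cat => /orP[/G0J|/G1J].
move=> d p Jp sp; have [dN|Nd] := ltnP d N.
  have [q [Gq sq Eq]] := HG1 d p dN Jp sp; exists q; split=> //.
  by apply: ideal_span_mono Gq => r /=; rewrite mem_cat orbC => ->.
have szG0 q : q \in G0 -> (size q <= d)%N.
  by move=> qG; apply: leq_trans Nd; apply: leq_bigmax_seq.
(* The shift moves the leading coefficient of [q] to degree [d], since [size q] is the degree plus
   one. *)
pose sh (q : {poly A}) := q * 'X^(d.+1 - size q).
have [||q [Gq sq Eq]] := @coef_seq_lift A d (map sh G0) p`_d.
- move=> _ /mapP[q /szG0 qd ->]; apply: leq_trans (size_polyMleq _ _) _.
  by rewrite size_polyXn addnS /= subnKC // ltnW.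
- have -> : p`_d = lead_coef p by rewrite lead_coefE sp.
  apply: ideal_span_min (HG0 p Jp); first exact: ideal_span_ideal.
  move=> _ /mapP[q qG ->]; rewrite lead_coefE.
  have [->|q0] := eqVneq q 0; first by rewrite coef0; apply: ideal_span0.
  have := szG0 q qG; have : (0 < size q)%N by rewrite size_poly_gt0.
  move=> s0 qd; apply: ideal_span_sub; rewrite -map_comp.
  apply/mapP; exists q => //=; rewrite coefMXn.
  move: (size q) s0 qd => e e0 ed; rewrite ifN; last by lia.
  by congr (_`_ _); lia.
exists q; split=> //; apply: ideal_span_min Gq; first exact: ideal_span_ideal.
move=> _ /mapP[r rG ->]; rewrite /sh mulrC; apply/ideal_spanM/ideal_span_sub.
by rewrite /= mem_cat rG.
Qed.

(* This is how finite generation is proved for rings of invariants: extending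
   an ideal along [Z] to [P] and applying the retraction [pr] gives it back. *)
Lemma noetherian_retract (P V A : comNzRingType) (Z : set P) (pr : P -> P)
    (phi : {rmorphism P -> V}) (val : {rmorphism A -> V}) :
  noetherian P -> injective val ->
  (forall q, Z (pr q)) -> (forall p q, pr (p + q) = pr p + pr q) ->
  (forall q z, Z z -> pr (q * z) = pr q * z) -> (forall z, Z z -> pr z = z) ->
  (forall z, Z z -> exists a, val a = phi z) ->
  (forall a, exists2 z, Z z & val a = phi z) ->
  noetherian A.
Proof.
move=> noP inj_val Zpr prD prM prZ Zval valZ; apply: noetherianP => J [J0 JD JM].
have pr0 : pr 0 = 0 by apply: (addrI (pr 0)); rewrite -prD !addr0.
have [s sT Hs] := noetherian_finite_image id
  [set z | Z z /\ exists2 a, J a & val a = phi z] noP.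
have [t tJ Ht] : exists2 t : seq A, (forall a, a \in t -> J a) &
    forall z, z \in s -> exists2 a, a \in t & val a = phi z.
  elim: s sT {Hs} => [|z s IHs] sT; first by exists [::].
  have [|t tJ Ht] := IHs; first by move=> y ys; apply: sT; rewrite inE ys orbT.
  have [_ [a Ja Ea]] := sT z (mem_head _ _); exists (a :: t).
    by move=> b; rewrite inE => /orP[/eqP -> //|/tJ].
  move=> y; rewrite inE => /orP[/eqP ->|/Ht[b bt Eb]].
    by exists a; rewrite ?mem_head.
  by exists b; rewrite // inE bt orbT.
exists t => // a Ja; have [z Zz Ea] := valZ a.
have [|r Hr Ez] := Hs z; first by split=> //; exists a.
have prs (u : seq (P * P)) : pr (\sum_(c <- u) c.1 * c.2) =
    \sum_(c <- u) pr (c.1 * c.2).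
  by elim: u => [|c u IHu]; rewrite ?big_nil ?big_cons // prD IHu.
(* Applying [pr] to the expression of [z] turns its coefficients into elements of [Z], which lift to
   [A]. *)
rewrite map_id in Hr; rewrite -(prZ z Zz) Ez prs in Ea.
elim: r a Hr Ea {Ez Ja} => [|c r IHr] a Hr.
  rewrite big_nil rmorph0 => Ea; suff -> : a = 0 by apply: ideal_span0.
  by apply: inj_val; rewrite Ea rmorph0.
have cs := Hr c (mem_head _ _); have [Zc _] := sT _ cs.
have [b bt Eb] := Ht _ cs; have [d Ed] := Zval _ (Zpr c.1).
rewrite big_cons rmorphD /= prM // rmorphM /= -Eb -Ed -rmorphM /= => Ea.
rewrite -(subrK (d * b) a) addrC; apply: ideal_spanD.
  exact/ideal_spanM/ideal_span_sub.
apply: IHr; first by move=> e er; apply: Hr; rewrite inE er orbT.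
by rewrite rmorphB Ea /= addrC addrA addNr add0r.
Qed.

Lemma noetherian_surj (P A : comNzRingType) (phi : {rmorphism P -> A}) :
  noetherian P -> (forall a, exists p, phi p = a) -> noetherian A.
Proof.
move=> noP surj.
apply: (@noetherian_retract P A A setT id phi (idfun : {rmorphism A -> A})) => //.
- by move=> z _; exists (phi z).
- by move=> a; have [p <-] := surj a; exists p.
Qed.

Lemma noetherian_mpoly (K : fieldType) (N : nat) : noetherian {mpoly K[N]}.
Proof.
elim: N => [|N IHN].
  apply: (@noetherian_surj K _ (@mpolyC 0 K)); first exact: noetherian_field.
  elim/mpolyind => [|c m p _ _ [q Eq]]; first by exists 0; rewrite rmorph0.
  have -> : m = 0%MM by apply/mnmP => -[].
  by exists (c + q); rewrite rmorphD /= Eq mpolyX0 -mul_mpolyC mulr1.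
(* Induction step: the indeterminate of the univariate ring goes to the last variable, the
   coefficients to polynomials in the first [N]. *)
have com : commr_rmorph (@mwiden N K) 'X_ord_max by move=> p; apply: mulrC.
apply: (@noetherian_surj _ _ (horner_morph com)); first exact: noetherian_poly.
pose im (a : {mpoly K[N.+1]}) := exists p, horner_morph com p = a.
have imM a b : im a -> im b -> im (a * b).
  by move=> [p <-] [q <-]; exists (p * q); rewrite rmorphM.
have imX m : im 'X_[m].
  rewrite mpolyXE_id; apply: big_ind => [|//|i _]; first by exists 1; rewrite rmorph1.
  have imXi : im 'X_i.
    have [j ->|->] := unliftP ord_max i; last by exists 'X; rewrite horner_morphX.
    exists ('X_j)%:P; rewrite horner_morphC /= mwidenX mnmwiden1.
    by congr 'X_[U_(_)]; apply/val_inj; rewrite /= /bump leqNgt ltn_ord.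
  by elim: (m i) => [|e IHe]; [exists 1; rewrite rmorph1 | rewrite exprS; apply: imM].
elim/mpolyind => [|c m p _ _ [q <-]]; first by exists 0; rewrite rmorph0.
have [|r Er] := imM (c%:MP) 'X_[m] _ (imX m).
  by exists (c%:MP)%:P; rewrite horner_morphC /= mwidenC.
by exists (r + q); rewrite rmorphD /= Er mul_mpolyC.
Qed.

(** * The plane blown up at four points *)

Definition kspan (K : fieldType) (V : lmodType K) (S : set V) : set V :=
  [set f | exists2 s : seq (K * V),
     (forall c, c \in s -> S c.2) & f = \sum_(c <- s) c.1 *: c.2].

Section KSpan.
Context (K : fieldType) (V : lmodType K).
Implicit Types (S T : set V) (f g : V).

Lemma kspan0 S : kspan S 0.
Proof. by exists [::] => //; rewrite big_nil. Qed.

Lemma kspanD S f g : kspan S f -> kspan S g -> kspan S (f + g).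
Proof.
case=> s Hs -> [t Ht ->]; exists (s ++ t); last by rewrite big_cat.
by move=> c; rewrite mem_cat => /orP[/Hs|/Ht].
Qed.

Lemma kspanZ S a f : kspan S f -> kspan S (a *: f).
Proof.
case=> s Hs ->; exists [seq (a * c.1, c.2) | c <- s].
  by move=> c /mapP[d ds ->]; apply: (Hs d).
by rewrite scaler_sumr big_map; apply: eq_bigr => c _; rewrite scalerA.
Qed.

Lemma kspanN S f : kspan S f -> kspan S (- f).
Proof. by move=> Sf; rewrite -scaleN1r; apply: kspanZ. Qed.

Lemma kspan_sub S f : S f -> kspan S f.
Proof.
move=> Sf; exists [:: (1, f)]; last by rewrite big_seq1 scale1r.
by move=> c; rewrite inE => /eqP ->.
Qed.

Lemma kspan_min S T :
  T 0 -> (forall f g, T f -> T g -> T (f + g)) ->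
  (forall a f, T f -> T (a *: f)) -> S `<=` T -> kspan S `<=` T.
Proof.
move=> T0 TD TZ ST f [s Hs ->]; rewrite big_seq; apply: big_ind => // c cs.
exact/TZ/ST/Hs.
Qed.

Lemma kspan_sum S (I : Type) (r : seq I) (P : pred I) (F : I -> V) :
  (forall i, P i -> kspan S (F i)) -> kspan S (\sum_(i <- r | P i) F i).
Proof. by move=> H; apply: big_ind => //; [apply: kspan0 | apply: kspanD]. Qed.

End KSpan.

(** * Order of vanishing at 0 of a polynomial *)

Section OrderAtZero.
Variable T : idomainType.
Implicit Types p q : {poly T}.

Definition ordge m p := forall k, (k < m)%N -> p`_k = 0.

Lemma ordge0 m : ordge m 0.
Proof. by move=> k _; rewrite coef0. Qed.

Lemma ordgeD m p q : ordge m p -> ordge m q -> ordge m (p + q).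
Proof. by move=> Hp Hq k km; rewrite coefD Hp // Hq // addr0. Qed.

Lemma ordgeM m k p q : ordge m p -> ordge k q -> ordge (m + k) (p * q).
Proof.
move=> Hp Hq i imk; rewrite coefM big1 // => j _.
have [jm|mj] := ltnP j m; first by rewrite Hp ?mul0r.
by rewrite (Hq (i - j)%N) ?mulr0 //; have := ltn_ord j; lia.
Qed.

Lemma ordgeMl m p q : ordge m q -> ordge m (p * q).
Proof. by move=> Hq; rewrite -[m]add0n; apply: ordgeM. Qed.

Lemma ordge_leq m k p : (k <= m)%N -> ordge m p -> ordge k p.
Proof. by move=> km Hp i ik; apply: Hp; apply: leq_trans km. Qed.

Lemma ordgeXn m p : ordge m ('X^m * p).
Proof. by move=> k km; rewrite coefXnM km. Qed.

(** The coefficient of index [k] in the product is [p]_0 * q[_k] plus terms in lower coefficients of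
    [q], which vanish by induction. *)
Lemma ordge_cancel m p q : p`_0 != 0 -> ordge m (p * q) -> ordge m q.
Proof.
move=> p0 Hpq k; elim/ltn_ind: k => k IHk km; have := Hpq k km.
rewrite coefM big_ord_recl big1 /= => [|i _].
  by rewrite subn0 addr0 => /eqP; rewrite mulf_eq0 (negPf p0) => /eqP.
by rewrite IHk ?mulr0 // /bump; have := ltn_ord i; lia.
Qed.

End OrderAtZero.

Lemma simplex_point Q p q r : (Q <= p + q + r)%N ->
  exists i j l, [/\ i + j + l = Q, i <= p, j <= q & l <= r]%N.
Proof.
move=> H; have [Qp|pQ] := leqP Q p; first by exists Q, 0%N, 0%N; split; lia.
have [Qq|qQ] := leqP (Q - p) q; first by exists p, (Q - p)%N, 0%N; split; lia.
by exists p, q, (Q - p - q)%N; split; lia.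
Qed.

(* The Cox ring of the blow-up of the projective plane at the coordinate points
   and at (1 : 1 : 1): [cox_mon], a product of the six lines joining these
   points, vanishes to the orders [j + l + a], [i + l + b], [i + j + c] and
   [a + b + c] there. *)
Section Cox.
Context (K : fieldType) (N : nat).
Local Notation R := {mpoly K[N]}.
Variables (X Y Z : R) (A B C D : nat).

Local Notation f1 := (Y - Z).
Local Notation f2 := (Z - X).
Local Notation f3 := (X - Y).

Definition cox_mon i j l a b c : R :=
  X ^+ i * Y ^+ j * Z ^+ l * (f1 ^+ a * f2 ^+ b * f3 ^+ c).

(** [D] is the degree, [A], [B], [C] are the orders required at (1 : 0 : 0), (0 : 1 : 0), (0 : 0 :
    1), and [k] is the one required at (1 : 1 : 1). *)
Definition cox_adm k i j l a b c :=
  [&& i + j + l + a + b + c == D, A <= j + l + a, B <= i + l + b,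
      C <= i + j + c & k <= a + b + c]%N.

Definition cox_space k : set R :=
  kspan [set f | exists i j l a b c,
                   cox_adm k i j l a b c /\ f = cox_mon i j l a b c].

Lemma cox_space_mon k i j l a b c :
  cox_adm k i j l a b c -> cox_space k (cox_mon i j l a b c).
Proof. by move=> H; apply: kspan_sub; exists i, j, l, a, b, c. Qed.

Lemma cox_monXY i j l a b c :
  cox_mon i.+1 j l a b c - cox_mon i j.+1 l a b c = cox_mon i j l a b c.+1.
Proof. by rewrite /cox_mon !exprS; ring. Qed.

Lemma cox_monYZ i j l a b c :
  cox_mon i j.+1 l a b c - cox_mon i j l.+1 a b c = cox_mon i j l a.+1 b c.
Proof. by rewrite /cox_mon !exprS; ring. Qed.

Lemma cox_monZX i j l a b c :
  cox_mon i j l.+1 a b c - cox_mon i.+1 j l a b c = cox_mon i j l a b.+1 c.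
Proof. by rewrite /cox_mon !exprS; ring. Qed.

(** The three lines through (1 : 1 : 1) lie in a pencil: f1 + f2 + f3 = 0. *)
Lemma cox_mon_pencil i j l a b c :
  cox_mon i j l a b c.+1 = - cox_mon i j l a.+1 b c - cox_mon i j l a b.+1 c.
Proof. by rewrite /cox_mon !exprS; ring. Qed.

(** From X f1 + Y f2 + Z f3 = 0. *)
Lemma cox_mon_plucker i j l a b c :
  cox_mon i j l.+1 a b c.+1 =
  - cox_mon i.+1 j l a.+1 b c - cox_mon i j.+1 l a b.+1 c.
Proof. by rewrite /cox_mon !exprS; ring. Qed.

(** Trading one factor X, Y or Z for another changes the monomial by one with an additional factor
    f1, f2 or f3, whose conditions follow from those at both ends. Unit trades lead from (i, j, l)
    to (i', j', l') through admissible exponents. *)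
Lemma cox_mon_exchange k i j l i' j' l' a b c :
  (a + b + c)%N = k ->
  cox_adm k i j l a b c -> cox_adm k i' j' l' a b c ->
  cox_space k.+1 (cox_mon i j l a b c - cox_mon i' j' l' a b c).
Proof.
rewrite /cox_adm => Ek + H'.
have [d] := ubnP ((i - i') + (i' - i) + (j - j') + (j' - j) +
                  (l - l') + (l' - l))%N.
elim: d i j l => // d IHd i j l dist H.
(* One trade that brings the exponents closer to the target suffices. *)
have go p q r : cox_adm k p q r a b c ->
    ((p - i') + (i' - p) + (q - j') + (j' - q) + (r - l') + (l' - r) < d)%N ->
    cox_space k.+1 (cox_mon i j l a b c - cox_mon p q r a b c) ->
    cox_space k.+1 (cox_mon i j l a b c - cox_mon i' j' l' a b c).
  move=> Hp pd ?; rewrite -(subrKA (cox_mon p q r a b c)).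
  by apply: kspanD => //; apply: IHd.
rewrite /cox_adm in go.
have [ii|ii|Ei] := ltngtP i i'.
- have [jj|jj] := ltnP j' j.
    case: j => // j in dist H go jj *.
    apply: (go i.+1 j l); try lia.
    rewrite -opprB cox_monXY; apply: kspanN; apply: cox_space_mon.
    by rewrite /cox_adm; lia.
  case: l => [|l] in dist H go *; first by lia.
  apply: (go i.+1 j l); try lia.
  by rewrite cox_monZX; apply: cox_space_mon; rewrite /cox_adm; lia.
- case: i => // i in dist H go ii *.
  have [jj|jj] := ltnP j j'.
    apply: (go i j.+1 l); try lia.
    by rewrite cox_monXY; apply: cox_space_mon; rewrite /cox_adm; lia.
  apply: (go i j l.+1); try lia.
  rewrite -opprB cox_monZX; apply: kspanN; apply: cox_space_mon.
  by rewrite /cox_adm; lia.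
- have [jj|jj|Ej] := ltngtP j j'.
  + case: l => [|l] in dist H go *; first by lia.
    apply: (go i j.+1 l); try lia.
    rewrite -opprB cox_monYZ; apply: kspanN; apply: cox_space_mon.
    by rewrite /cox_adm; lia.
  + case: j => // j in dist H go jj *.
    apply: (go i j l.+1); try lia.
    by rewrite cox_monYZ; apply: cox_space_mon; rewrite /cox_adm; lia.
  + have -> : l = l' by lia.
    by rewrite Ei Ej subrr; apply: kspan0.
Qed.

(** * Normal forms modulo higher order at (1 : 1 : 1) *)

Section Layer.
Variable k : nat.
(** When a + b + c = k, one has i + j + l = Q, and the conditions read i + A <= Q + a, j + B <= Q +
    b, l + C <= Q + c. Hence [g] is the least possible c, while [i0] and [j0] choose i and then j as
    large as allowed. *)
Let Q := (D - k)%N.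
Let g := (C - Q)%N.
Let i0 a := minn Q (Q + a - A).
Let j0 a b := minn (Q - i0 a) (Q + b - B).

Definition cox_std e : R :=
  let b := (k - g - e)%N in
  cox_mon (i0 e) (j0 e b) (Q - i0 e - j0 e b) e b g.

Definition cox_reducible (f : R) := exists la : nat -> K,
  cox_space k.+1 (f - \sum_(e < (k - g).+1) la e *: cox_std e).

Lemma cox_reducibleW f : cox_space k.+1 f -> cox_reducible f.
Proof.
by exists (fun=> 0); rewrite big1 ?subr0 // => e _; rewrite scale0r.
Qed.

Lemma cox_reducibleD f h :
  cox_reducible f -> cox_reducible h -> cox_reducible (f + h).
Proof.
move=> [la Hf] [mu Hh]; exists (fun e => la e + mu e).
under eq_bigr => e _ do rewrite scalerDl.
by rewrite big_split /= opprD addrACA; apply: kspanD.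
Qed.

Lemma cox_reducibleZ x f : cox_reducible f -> cox_reducible (x *: f).
Proof.
move=> [la Hf]; exists (fun e => x * la e).
under eq_bigr => e _ do rewrite -scalerA.
by rewrite -scaler_sumr -scalerBr; apply: kspanZ.
Qed.

Lemma cox_reducibleN f : cox_reducible f -> cox_reducible (- f).
Proof. by rewrite -scaleN1r; apply: cox_reducibleZ. Qed.

Lemma cox_mon_reducible_min i j l a b c :
  (a + b + c)%N = k -> c = g -> cox_adm k i j l a b c ->
  cox_reducible (cox_mon i j l a b c).
Proof.
move=> Ek Ec H.
have ltak : (a < (k - g).+1)%N by lia.
exists (fun e => (e == a)%:R).
rewrite (bigD1 (Ordinal ltak)) //= eqxx scale1r big1 => [|e ne].
  rewrite addr0 /cox_std (_ : (k - g - a)%N = b); last by lia.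
  rewrite -Ec; apply: cox_mon_exchange => //.
  by move: H; rewrite /cox_adm /j0 /i0 /g /Q in Ec *; lia.
case: eqP => [E|]; last by rewrite scale0r.
by case/eqP: ne; apply/val_inj.
Qed.

(** If a + b + c > k the monomial is already in the next space. Otherwise induction lowers c to [g],
    by the pencil relation or by the relation X f1 + Y f2 + Z f3 = 0, according to the size of A + B
    + C; for c = [g] the exchange lemma leads to [cox_std]. *)
Lemma cox_mon_reducible i j l a b c :
  cox_adm k i j l a b c -> cox_reducible (cox_mon i j l a b c).
Proof.
have [kabc|abck H] := ltnP k (a + b + c).
  move=> H; apply/cox_reducibleW/cox_space_mon.
  by move: H; rewrite /cox_adm; lia.
have {abck} Ek : (a + b + c)%N = k by move: H; rewrite /cox_adm; lia.
have gc : (g <= c)%N by move: H; rewrite /cox_adm /g /Q; lia.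
elim: c gc i j l a b H Ek => [|c IHc] gc i j l a b H Ek; last first.
  have [gc'|cg] := leqP g c; last first.
    have Eg : c.+1 = g by lia.
    exact: cox_mon_reducible_min.
  (* Under the strict bound there are exponents of X, Y, Z still admissible after f3 loses one
     factor: the three upper bounds on them add up to at least [Q]. *)
  have [lt2Q|le2Q] := ltnP (A + B + C) (2 * Q + k).
    have [i1 [j1 [l1 [E1 le_i1 le_j1 le_l1]]]] :
        exists i1 j1 l1, [/\ i1 + j1 + l1 = Q, i1 + A <= Q + a, j1 + B <= Q + b
                           & l1 + C <= Q + c]%N.
      have [|i1 [j1 [l1 [? ? ? ?]]]] :=
        @simplex_point Q (Q + a - A) (Q + b - B) (Q + c - C).
        by move: H; rewrite /cox_adm /g /Q in gc' lt2Q *; lia.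
      exists i1, j1, l1.
      by move: H; rewrite /cox_adm /g /Q in gc' lt2Q *; split; lia.
    have adm1 : cox_adm k i1 j1 l1 a b c.+1.
      by move: H; rewrite /cox_adm /Q in E1 le_i1 le_j1 le_l1 *; lia.
    rewrite -(subrK (cox_mon i1 j1 l1 a b c.+1) (cox_mon i j l a b c.+1)).
    apply: cox_reducibleD.
      by apply/cox_reducibleW/cox_mon_exchange.
    rewrite cox_mon_pencil; apply: cox_reducibleD; apply: cox_reducibleN.
      apply: IHc => //; last by lia.
      by move: adm1; rewrite /cox_adm /Q in E1 le_i1 le_j1 le_l1 *; lia.
    apply: IHc => //; last by lia.
    by move: adm1; rewrite /cox_adm /Q in E1 le_i1 le_j1 le_l1 *; lia.
  (* The bounds on i and j now force l >= Q - C + c + 1 > 0, so a factor Z f3 is available. *)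
  have l_gt0 : (0 < l)%N by move: H; rewrite /cox_adm /g /Q in gc' le2Q *; lia.
  case: l l_gt0 H => // l _ H; rewrite cox_mon_plucker.
  apply: cox_reducibleD; apply: cox_reducibleN; (apply: IHc; [by []| |by lia]).
    by move: H; rewrite /cox_adm /g /Q in gc' le2Q *; lia.
  by move: H; rewrite /cox_adm /g /Q in gc' le2Q *; lia.
have Eg : 0%N = g by lia.
exact: cox_mon_reducible_min.
Qed.

Lemma cox_space_reducible f : cox_space k f -> cox_reducible f.
Proof.
apply: kspan_min.
- exact/cox_reducibleW/kspan0.
- exact: cox_reducibleD.
- exact: cox_reducibleZ.
by move=> _ [i [j [l [a [b [c [H ->]]]]]]]; apply: cox_mon_reducible.
Qed.

End Layer.

(** * Leading forms in a chart at (1 : 1 : 1) *)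

Variables (nu : K) (eta : {rmorphism R -> {poly {poly K}}}).
Variables (g1 g2 g3 : {poly {poly K}}).
(** The outer indeterminate measures the order at (1 : 1 : 1) and the inner one, s, is the direction
    of a line through that point. The leading forms nu s, nu and - nu (1 + s) add up to 0, in
    accordance with f1 + f2 + f3 = 0. *)
Hypotheses (nu0 : nu != 0)
  (etaZ : forall c f, eta (c *: f) = c%:P%:P * eta f)
  (etaX : (eta X)`_0 = 1) (etaY : (eta Y)`_0 = 1) (eta_Z : (eta Z)`_0 = 1)
  (eta1 : eta f1 = 'X * g1) (eta2 : eta f2 = 'X * g2) (eta3 : eta f3 = 'X * g3)
  (g1_0 : g1`_0 = nu *: 'X) (g2_0 : g2`_0 = nu%:P)
  (g3_0 : g3`_0 = - nu *: (1 + 'X)).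

Lemma eta_cox_mon i j l a b c :
  exists2 q, eta (cox_mon i j l a b c) = 'X^(a + b + c) * q &
    q`_0 = (nu *: 'X) ^+ a * nu%:P ^+ b * (- nu *: (1 + 'X)) ^+ c.
Proof.
exists (eta X ^+ i * eta Y ^+ j * eta Z ^+ l * (g1 ^+ a * g2 ^+ b * g3 ^+ c)).
  rewrite /cox_mon !(rmorphM, rmorphXn) /= eta1 eta2 eta3 !exprMn !exprD.
  by ring.
by rewrite -!horner_coef0 !(hornerM, horner_exp) !horner_coef0 etaX etaY eta_Z
  g1_0 g2_0 g3_0 !expr1n !mul1r.
Qed.

Lemma ordge_cox_space k f : cox_space k f -> ordge k (eta f).
Proof.
apply: (kspan_min (T := [set f | ordge k (eta f)])) => /=.
- by rewrite rmorph0; apply: ordge0.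
- by move=> f' h Hf Hh; rewrite rmorphD; apply: ordgeD.
- by move=> x f' Hf; rewrite etaZ; apply: ordgeMl.
move=> _ [i [j [l [a [b [c [/and5P[_ _ _ _ kabc] ->]]]]]]].
have [q Eq _] := eta_cox_mon i j l a b c; rewrite /= Eq.
exact: ordge_leq (ordgeXn _).
Qed.

(** Modulo order k + 1, [f] is a combination of the [cox_std k e], with leading forms proportional
    to (1 + s)^g s^e. These are linearly independent, so all coefficients vanish when [f] has order
    k + 1. *)
Lemma cox_space_step k f :
  cox_space k f -> ordge k.+1 (eta f) -> cox_space k.+1 f.
Proof.
move=> Hf ordf; have [la Hla] := cox_space_reducible Hf.
(* For k > D no monomial is admissible. *)
have [kD|Dk] := leqP k D; last first.
  apply: kspan_min Hf; [exact: kspan0 | exact: kspanD | exact: kspanZ |].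
  move=> _ [i [j [l [a [b [c [/and5P[H _ _ _ H5] ->]]]]]]]; exfalso; lia.
set g := (C - (D - k))%N in Hla *.
(* For g > k no admissible monomial has a + b + c = k, so the order at (1 : 1 : 1) is already k +
   1. *)
have [gk|kg] := leqP g k; last first.
  apply: kspan_min Hf; [exact: kspan0 | exact: kspanD | exact: kspanZ |].
  move=> _ [i [j [l [a [b [c [H ->]]]]]]]; apply: cox_space_mon.
  by move: H; rewrite /cox_adm /g in kg *; lia.
suff la0 : forall e, (e < (k - g).+1)%N -> la e = 0.
  rewrite big1 ?subr0 // in Hla.
  by move=> e _; rewrite la0 ?scale0r.
set S := \sum_(e < _) _ in Hla.
have : (eta S)`_k = 0.
  have -> : S = f - (f - S) by rewrite subKr.
  rewrite rmorphB coefB ordf // sub0r.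
  by rewrite (ordge_cox_space Hla) ?oppr0.
rewrite /S rmorph_sum coef_sum.
have Ecoef (e : 'I_(k - g).+1) : (eta (la e *: cox_std k e))`_k =
    (- 1) ^+ g * nu%:P ^+ k * (1 + 'X) ^+ g * (la e *: 'X^e).
  rewrite etaZ /cox_std -/g; set i := minn _ _; set j := minn _ _.
  have [q -> q0] := eta_cox_mon i j (D - k - i - j) e (k - g - e) g.
  have Ek : (e + (k - g - e) + g)%N = k by have := ltn_ord e; lia.
  have -> : nu%:P ^+ k = nu%:P ^+ e * nu%:P ^+ (k - g - e) * nu%:P ^+ g.
    by rewrite -!exprD Ek.
  rewrite coefCM Ek coefXnM ltnn subnn q0 -!mul_polyC polyCN !exprMn.
  by rewrite (exprNn nu%:P); ring.
under eq_bigr => e _ do rewrite Ecoef.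
(* The common factor is nonzero and cancels, leaving a polynomial in s whose coefficients are the
   [la e]. *)
rewrite -mulr_sumr => /eqP; rewrite mulf_eq0 => /orP[|/eqP sum0]; last first.
  move=> e lte; have := congr1 (coefp e) sum0.
  rewrite /= coef0 coef_sum (bigD1 (Ordinal lte)) //= big1 => [|e' ne'].
    by rewrite addr0 coefZ coefXn eqxx mulr1.
  rewrite coefZ coefXn; case: eqP => [E|]; last by rewrite mulr0.
  by case/eqP: ne'; apply/val_inj.
rewrite !mulf_eq0 !expf_eq0 oppr_eq0 oner_eq0 polyC_eq0 (negPf nu0) !andbF /=.
move=> /andP[_ /eqP /(congr1 (coefp 1))]; rewrite /= coefD coef1 coefX coef0 /=.
by rewrite add0r => /eqP; rewrite oner_eq0.
Qed.

Lemma cox_space_ordge m f : cox_space 0 f -> ordge m (eta f) -> cox_space m f.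
Proof.
move=> Hf; elim: m => // m IHm ordf.
by apply: cox_space_step => //; apply: IHm; apply: ordge_leq ordf.
Qed.

End Cox.

(** * Forms vanishing at the Fermat points *)

Section FermatCoordinates.
Context (K : fieldType).
Local Notation R := {mpoly K[3]}.
Local Notation x := ('X_(inord 0) : R).
Local Notation y := ('X_(inord 1) : R).
Local Notation z := ('X_(inord 2) : R).

Lemma mpolyX3 (mm : 'X_{1..3}) :
  'X_[mm] = x ^+ mm (inord 0) * y ^+ mm (inord 1) * z ^+ mm (inord 2).
Proof.
rewrite mpolyXE_id !big_ord_recl big_ord0 mulr1 mulrA.
by congr (_ ^+ _ * _ ^+ _ * _ ^+ _);
  do ?congr 'X_[U_(_)]; do ?congr (mm _); apply/val_inj; rewrite /= inordK.
Qed.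

Lemma mdeg3 (mm : 'X_{1..3}) :
  mdeg mm = (mm (inord 0) + mm (inord 1) + mm (inord 2))%N.
Proof.
rewrite mdegE !big_ord_recl big_ord0 addn0 addnA.
by congr (_ + _ + _)%N; congr (mm _); apply/val_inj; rewrite /= inordK.
Qed.

Definition coord3 (T : Type) (a b c : T) (i : 'I_3) : T :=
  if val i == 0%N then a else if val i == 1%N then b else c.

Definition subst3 (T : comNzRingType) (f : {rmorphism K -> T}) (a b c : T) :
  {rmorphism R -> T} := mmap f (coord3 a b c).

Section Subst3.
Variables (T : comNzRingType) (f : {rmorphism K -> T}) (a b c : T).

Lemma subst3x : subst3 f a b c x = a.
Proof. by rewrite /subst3 /= mmapX mmap1U /coord3 /= inordK. Qed.

Lemma subst3y : subst3 f a b c y = b.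
Proof. by rewrite /subst3 /= mmapX mmap1U /coord3 /= inordK. Qed.

Lemma subst3z : subst3 f a b c z = c.
Proof. by rewrite /subst3 /= mmapX mmap1U /coord3 /= inordK. Qed.

Lemma subst3C k : subst3 f a b c k%:MP = f k.
Proof. by rewrite /subst3 /= mmapC. Qed.

Lemma subst3Z k p : subst3 f a b c (k *: p) = f k * subst3 f a b c p.
Proof. by rewrite /subst3 /= mmapZ. Qed.

Definition subst3E := (subst3x, subst3y, subst3z, subst3C, subst3Z).

End Subst3.

Lemma mpoly3_rect (P : set R) :
  (forall k, P k%:MP) -> P x -> P y -> P z ->
  (forall p q, P p -> P q -> P (p + q)) ->
  (forall p q, P p -> P q -> P (p * q)) -> forall p, P p.
Proof.
move=> PC Px Py Pz PD PM.
have PX q e : P q -> P (q ^+ e).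
  move=> Pq; elim: e => [|e IHe]; first by rewrite expr0 -mpolyC1.
  by rewrite exprS; apply: PM.
elim/mpolyind => [|k mm p _ _ Pp]; first by rewrite -mpolyC0.
apply: PD => //; rewrite -mul_mpolyC mpolyX3; apply: (PM) => //.
by apply: (PM); [apply: (PM)|]; apply: PX.
Qed.

End FermatCoordinates.

(** The [c i] are the coefficients of a polynomial of size at most [n] with at least [n] distinct
    roots. *)
Lemma vandermonde_eq0 (T : idomainType) (n : nat) (s : seq T) (c : nat -> T) :
  uniq s -> (n <= size s)%N ->
  (forall u, u \in s -> \sum_(i < n) u ^+ i * c i = 0) ->
  forall i, (i < n)%N -> c i = 0.
Proof.
move=> us ns H i lin.
have p0 : \poly_(i < n) c i = 0.
  apply: (@roots_geq_poly_eq0 _ _ s) => //; last first.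
    exact: leq_trans (size_poly _ _) ns.
  apply/allP => u /H Hu; rewrite rootE horner_poly -{2}Hu; apply/eqP.
  by apply: eq_bigr => j _; rewrite mulrC.
by have := congr1 (coefp i) p0; rewrite /= coef_poly lin coef0.
Qed.

(** Rounding up turns a condition on the exponents of x, y, z into one on those of x^n, y^n, z^n. *)
Lemma leq_ceil_div n r m q : (0 < n)%N ->
  ((m - r + n.-1) %/ n <= q)%N = (m <= r + n * q)%N.
Proof.
move=> n0; rewrite -ltnS ltn_divLR // mulSn [(q * n)%N]mulnC.
by apply/idP/idP; case: n n0 => //= n _; lia.
Qed.

Lemma exp1Dpoly (T : comNzRingType) (u : T) n :
  exists2 h : {poly T}, (1 + u%:P * 'X) ^+ n = 1 + 'X * h & h`_0 = u *+ n.
Proof.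
elim: n => [|n [h Eh h0]].
  by exists 0; rewrite ?expr0 ?mulr0 ?addr0 ?coef0 ?mulr0n.
exists (h + u%:P + u%:P * 'X * h); first by rewrite exprS Eh; ring.
by rewrite -mulrA !coefD coefC eqxx h0 coefCM coefXM eqxx mulr0 addr0 mulrSr.
Qed.

Section FermatSpace.
Context (K : fieldType) (n : nat).
Local Notation R := {mpoly K[3]}.
Local Notation x := ('X_(inord 0) : R).
Local Notation y := ('X_(inord 1) : R).
Local Notation z := ('X_(inord 2) : R).

Definition fermat_mon e1 e2 e3 a b c : R :=
  x ^+ e1 * y ^+ e2 * z ^+ e3 *
  ((y ^+ n - z ^+ n) ^+ a * (z ^+ n - x ^+ n) ^+ b * (x ^+ n - y ^+ n) ^+ c).

Definition fermat_adm m e1 e2 e3 a b c :=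
  [&& m <= e2 + e3 + n * a, m <= e1 + e3 + n * b, m <= e1 + e2 + n * c
    & m <= a + b + c]%N.

Definition fermat_space m : set R :=
  kspan [set f | exists e1 e2 e3 a b c,
    fermat_adm m e1 e2 e3 a b c /\ f = fermat_mon e1 e2 e3 a b c].

Lemma fermat_mon_cox e1 e2 e3 i j l a b c :
  x ^+ e1 * y ^+ e2 * z ^+ e3 *
    cox_mon (x ^+ n) (y ^+ n) (z ^+ n) i j l a b c =
  fermat_mon (e1 + n * i) (e2 + n * j) (e3 + n * l) a b c.
Proof. by rewrite /cox_mon /fermat_mon !exprD !exprM; ring. Qed.

Local Notation KC := ((polyC : {rmorphism {poly K} -> {poly {poly K}}}) \o
  (polyC : {rmorphism K -> {poly K}})).

(** The lines through (1 : 1 : 1) in the affine plane z = 1: the point at parameter T in direction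
    (-1, s), with T outer and s inner. *)
Definition chart : {rmorphism R -> {poly {poly K}}} :=
  subst3 KC (1 - 'X) (1 + 'X%:P * 'X) 1.

Lemma cox_fermat_space (n0 : n%:R != 0 :> K) m D e1 e2 e3 (S : R) :
  let ceil r := ((m - r + n.-1) %/ n)%N in
  cox_space (x ^+ n) (y ^+ n) (z ^+ n)
    (ceil (e2 + e3)%N) (ceil (e1 + e3)%N) (ceil (e1 + e2)%N) D 0 S ->
  ordge m (chart (x ^+ e1 * y ^+ e2 * z ^+ e3 * S)) ->
  fermat_space m (x ^+ e1 * y ^+ e2 * z ^+ e3 * S).
Proof.
move=> ceil HS; rewrite rmorphM => /ordge_cancel ordS.
(* The monomial in x, y, z has constant term 1 in the chart, so the order is that of [S]. *)
have n_gt0 : (0 < n)%N by case: (n) n0 => //; rewrite eqxx.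
have {ordS}ordS : ordge m (chart S).
  apply: ordS; rewrite !rmorphM !rmorphXn /= -horner_coef0.
  rewrite !subst3E !(hornerM, horner_exp) !hornerE.
  by rewrite ?(mulr0, addr0, subr0, expr1n, mulr1) oner_eq0.
have [hs Ehs hs0] := exp1Dpoly ('X : {poly K}) n.
have [hu Ehu hu0] := exp1Dpoly (- 1 : {poly K}) n.
have chX : chart (x ^+ n) = 1 + 'X * hu.
  by rewrite rmorphXn /= subst3E -Ehu polyCN mulN1r.
have chY : chart (y ^+ n) = 1 + 'X * hs by rewrite rmorphXn /= subst3E.
have chZ : chart (z ^+ n) = 1 by rewrite rmorphXn /= subst3E expr1n.
(* Here nu = n, from the linear terms of (1 + s T)^n and (1 - T)^n; it is nonzero in [K] by [n0]. *)
have := @cox_space_ordge K 3 (x ^+ n) (y ^+ n) (z ^+ n) _ _ _ D n%:R chart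
  hs (- hu) (hu - hs) n0 _ _ _ _ _ _ _ _ _ _ m S HS ordS.
move=> H; apply: (kspan_min (T := [set f |
  fermat_space m (x ^+ e1 * y ^+ e2 * z ^+ e3 * f)])
  _ _ _ _ (H _ _ _ _ _ _ _ _ _ _)) => /=.
- by rewrite mulr0; apply: kspan0.
- by move=> f g Hf Hg; rewrite mulrDr; apply: kspanD.
- by move=> a f Hf; rewrite -scalerAr; apply: kspanZ.
- move=> _ [i [j [l [a [b [c [adm ->]]]]]]] /=; rewrite fermat_mon_cox.
  apply: kspan_sub; do 6!eexists; split; last by [].
  move: adm => /and5P[_]; rewrite /ceil !leq_ceil_div // => H1 H2 H3 H4.
  by rewrite /fermat_adm H4 andbT; apply/and3P; split; lia.
- by move=> c f; rewrite /chart subst3Z.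
- by rewrite chX coefD coef1 coefXM addr0.
- by rewrite chY coefD coef1 coefXM addr0.
- by rewrite chZ coef1.
- by rewrite rmorphB chY chZ addrC addKr.
- by rewrite rmorphB chX chZ; ring.
- by rewrite rmorphB chX chY; ring.
- by rewrite hs0 scaler_nat.
- by rewrite coefN hu0 mulNrn opprK -polyC_natr.
- by rewrite coefB hs0 hu0 -mul_polyC polyCN polyC_natr; ring.
Qed.

(** * Splitting along exponents modulo n and degree *)

Section Components.
Variable F : R.

Definition fermat_key i j d (mm : 'X_{1..3}) :=
  [&& mm (inord 0) %% n == i, mm (inord 1) %% n == j & mdeg mm == d]%N.

Definition fermat_comp i j d : R :=
  \sum_(mm <- msupp F | fermat_key i j d mm) F@_mm *: 'X_[mm].

Lemma fermat_compE : (0 < n)%N ->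
  F = \sum_(q : 'I_n * 'I_n * 'I_(msize F).+1) fermat_comp q.1.1 q.1.2 q.2.
Proof.
move=> n0; rewrite {1}(mpolyE F).
(* Degrees in the support are below [msize F]; the successor in the index type keeps it inhabited,
   as [inord] requires. *)
pose key (mm : 'X_{1..3}) : 'I_n * 'I_n * 'I_(msize F).+1 :=
  (Ordinal (ltn_pmod (mm (inord 0)) n0), Ordinal (ltn_pmod (mm (inord 1)) n0),
   inord (mdeg mm)).
rewrite (partition_big key predT) //=; apply: eq_bigr => -[[i j] d] _.
rewrite /fermat_comp big_seq_cond [RHS]big_seq_cond; apply: eq_bigl => mm /=.
case mF: (mm \in msupp F) => //=; have lt3 := msize_mdeg_lt mF.
rewrite /key /fermat_key -!pair_eqE /= -!val_eqE /= inordK ?andbA //.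
exact: leqW.
Qed.

(** The chart at (al : be : 1), rescaled by the middle indeterminate, which records the degree. *)
Definition point_chart (al be : K) : {rmorphism R -> {poly {poly {poly K}}}} :=
  let cst := (polyC : {rmorphism {poly {poly K}} -> _}) \o KC in
  let zt := ('X : {poly {poly K}})%:P in
  subst3 cst (cst al * zt * (1 - 'X)) (cst be * zt * (1 + ('X%:P)%:P * 'X)) zt.

Lemma coef_point_chart_comp al be i j d k :
  al ^+ n = 1 -> be ^+ n = 1 ->
  (point_chart al be (fermat_comp i j d))`_k =
    'X^d * ((al ^+ i * be ^+ j)%:P * (chart (fermat_comp i j d))`_k)%:P.
Proof.
move=> al1 be1; rewrite /fermat_comp !rmorph_sum !coef_sum mulr_sumr.
rewrite rmorph_sum mulr_sumr.
apply: eq_bigr => mm /and3P[/eqP <- /eqP <- /eqP <-].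
rewrite !expr_mod // {1}/point_chart /chart !subst3Z mpolyX3.
rewrite !rmorphM !rmorphXn /= !subst3E expr1n mulr1.
rewrite [X in (polyseq X)`_k = _](_ : _ =
  ('X^(mdeg mm) * (al ^+ mm (inord 0) * be ^+ mm (inord 1))%:P%:P)%:P
  * map_poly polyC ((F@_mm)%:P%:P *
       ((1 - 'X) ^+ mm (inord 0) * (1 + 'X%:P * 'X) ^+ mm (inord 1)))); last first.
  rewrite !rmorphM !rmorphXn /= rmorphB rmorphD rmorphM !rmorph1 /=.
  rewrite !map_polyC !map_polyX /= mdeg3 !exprD !exprMn.
  by ring.
by rewrite coefCM coef_map !rmorphM !rmorphXn /= !mulrA.
Qed.

(** The power of the middle indeterminate isolates the degree [d]. What is left is a sum over
    residues i, j weighted by al^i be^j, separated by two Vandermonde arguments on the [n] roots of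
    unity. *)
Lemma ordge_chart_comp m (s : seq K) :
  (0 < n)%N -> size s = n -> uniq s -> (forall a, a \in s -> a ^+ n = 1) ->
  (forall al be, al ^+ n = 1 -> be ^+ n = 1 -> ordge m (point_chart al be F)) ->
  forall i j d, (i < n)%N -> (j < n)%N -> (d < (msize F).+1)%N ->
  ordge m (chart (fermat_comp i j d)).
Proof.
move=> n0 sz us s1 H i j d lin ltj ltd k km.
have us' : uniq (map (@polyC K) s) by rewrite map_inj_uniq //; apply: polyC_inj.
have sz' : (n <= size (map (@polyC K) s))%N by rewrite size_map sz.
pose c i j := (chart (fermat_comp i j d))`_k.
apply: (@vandermonde_eq0 _ _ _ (c^~ j) us' sz') lin => _ /mapP[al /s1 al1 ->].
apply: (@vandermonde_eq0 _ _ _ (fun j => \sum_(i < n) al%:P ^+ i * c i j)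
  us' sz') ltj => _ /mapP[be /s1 be1 ->].
have /(congr1 (coefp d)) := H al be al1 be1 k km.
rewrite {1}(fermat_compE n0) rmorph_sum coef_sum /= coef0 coef_sum => E.
rewrite -[RHS]E {E}.
under eq_bigr => j' _ do rewrite mulr_sumr.
rewrite exchange_big pair_bigA /=.
rewrite -(pair_bigA _ (fun (p : 'I_n * 'I_n) (e : 'I_(msize F).+1) =>
  ((point_chart al be (fermat_comp p.1 p.2 e))`_k)`_d)) /=.
apply: eq_bigr => -[i' j'] _ /=; rewrite (bigD1 (Ordinal ltd)) //= big1.
  rewrite coef_point_chart_comp // coefMC coefXn eqxx mul1r addr0 /c.
  by rewrite rmorphM !rmorphXn /=; ring.
move=> e ne; rewrite coef_point_chart_comp // coefMC coefXn.
case: eqP => [Ed|]; last by rewrite mul0r.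
by case/eqP: ne; apply/val_inj.
Qed.

Lemma fermat_comp_space m i j d (n0 : n%:R != 0 :> K) :
  (forall mm, mm \in msupp F -> [&& m <= mm (inord 1) + mm (inord 2),
     m <= mm (inord 0) + mm (inord 2) & m <= mm (inord 0) + mm (inord 1)]%N) ->
  ordge m (chart (fermat_comp i j d)) -> fermat_space m (fermat_comp i j d).
Proof.
move=> supp ord; have n_gt0 : (0 < n)%N by case: (n) n0 => //; rewrite eqxx.
(* The residues of the exponents of x and y and the degree determine the residue [l] of the exponent
   of z, and the degree [D] in x^n, y^n, z^n of the remaining factor. *)
pose l := ((d - i - j) %% n)%N; pose D := ((d - i - j) %/ n)%N.
pose S := \sum_(mm <- msupp F | fermat_key i j d mm) F@_mm *:
  cox_mon (x ^+ n) (y ^+ n) (z ^+ n) (mm (inord 0) %/ n) (mm (inord 1) %/ n)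
    (mm (inord 2) %/ n) 0 0 0.
have key mm : fermat_key i j d mm ->
    [/\ mm (inord 0) = i + n * (mm (inord 0) %/ n),
        mm (inord 1) = j + n * (mm (inord 1) %/ n),
        mm (inord 2) = l + n * (mm (inord 2) %/ n) &
        mm (inord 0) %/ n + mm (inord 1) %/ n + mm (inord 2) %/ n = D]%N.
  move=> /and3P[/eqP E0 /eqP E1 /eqP]; rewrite mdeg3 => E2.
  have := divn_eq (mm (inord 0)) n; have := divn_eq (mm (inord 1)) n.
  rewrite E0 E1 => E1' E0'.
  have Ed : (d - i - j = (mm (inord 0) %/ n + mm (inord 1) %/ n) * n +
     mm (inord 2))%N.
    rewrite mulnDl -E2; move: E0' E1'.
    move: (mm (inord 0)) (mm (inord 1)) (mm (inord 2)) => m0 m1 m2.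
    move: (m0 %/ n * n)%N (m1 %/ n * n)%N => a b; lia.
  rewrite /l /D Ed modnMDl divnMDl //.
  by split; rewrite // addnC mulnC // -divn_eq.
have ES : fermat_comp i j d = x ^+ i * y ^+ j * z ^+ l * S.
  rewrite /S mulr_sumr; apply: eq_bigr => mm /key[E0 E1 E2 _].
  rewrite -scalerAr fermat_mon_cox -E0 -E1 -E2 mpolyX3 /fermat_mon.
  by rewrite !expr0 !mulr1.
rewrite ES in ord *; apply: (cox_fermat_space n0 (D := D)) => //.
rewrite /S big_seq_cond; apply: kspan_sum => mm /andP[/supp/and3P[H1 H2 H3]].
move=> /key[E0 E1 E2 ED]; apply: kspanZ; apply: cox_space_mon.
rewrite /cox_adm !leq_ceil_div // ED !addn0 eqxx /=.
by apply/and3P; split; lia.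
Qed.

End Components.

(** The condition on the support is vanishing to order [m] at the coordinate points; the one on the
    charts is the same at the other n^2 points. Both pass to the components of [F]. *)
Lemma fermat_spaceP m (F : R) (s : seq K) :
  n%:R != 0 :> K -> size s = n -> uniq s -> (forall a, a \in s -> a ^+ n = 1) ->
  (forall mm, mm \in msupp F -> [&& m <= mm (inord 1) + mm (inord 2),
     m <= mm (inord 0) + mm (inord 2) & m <= mm (inord 0) + mm (inord 1)]%N) ->
  (forall al be, al ^+ n = 1 -> be ^+ n = 1 -> ordge m (point_chart al be F)) ->
  fermat_space m F.
Proof.
move=> n0 sz us s1 supp ord.
have n_gt0 : (0 < n)%N by case: (n) n0 => //; rewrite eqxx.
rewrite (fermat_compE F n_gt0); apply: kspan_sum => -[[i j] d] _ /=.
by apply: fermat_comp_space => //; apply: (@ordge_chart_comp F m s).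
Qed.

End FermatSpace.

(** * Symbolic powers of the Fermat ideal *)

Lemma prime_idealX (R : comNzRingType) (p : set R) a k :
  is_prime_ideal p -> ~ p a -> ~ p (a ^+ k).
Proof.
move=> [_ p1 pM] pa; elim: k => [|k IHk]; first by rewrite expr0.
by rewrite exprS => /pM[].
Qed.

Section Localization.
Variables (R : idomainType) (p J : set R).
Hypotheses (pr_p : is_prime_ideal p) (idJ : is_ideal J).

(** Clearing denominators: the product of the finitely many denominators stays outside the prime
    [p]. *)
Lemma local_ext_tofrac F :
  local_ext p J (tofrac F) <-> exists2 s, ~ p s & J (s * F).
Proof.
have [J0 JD JM] := idJ; have [[p0 _ _] p1 pM] := pr_p.
have nz s : ~ p s -> tofrac s != 0.
  by move=> ps; rewrite tofrac_eq0; apply/eqP => s0; apply: ps; rewrite s0.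
split=> [[r Hr EF]|[s ps JsF]]; last first.
  exists [:: (tofrac 1 / tofrac s, s * F)].
    move=> c; rewrite inE => /eqP -> /=; split=> //; exists 1, s.
    by split.
  by rewrite big_seq1 /= rmorph1 div1r rmorphM /= mulrA mulVf ?mul1r // nz.
have [t pt [j Jj Etj]] : exists2 t, ~ p t & exists2 j, J j &
    tofrac t * (\sum_(c <- r) c.1 * tofrac c.2) = tofrac j.
  elim: r Hr {EF} => [|c r IHr] Hr.
    by exists 1 => //; exists 0 => //; rewrite big_nil mulr0 rmorph0.
  have [|t pt [j Jj Ej]] := IHr; first by move=> d dr; apply: Hr; rewrite inE dr orbT.
  have [[a [s [ps Ec]]] Jc] := Hr c (mem_head _ _).
  exists (s * t); first by case/pM.
  exists (a * t * c.2 + s * j); first by apply: JD; apply: JM.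
  rewrite big_cons mulrDr !rmorphM rmorphD !rmorphM /= -Ej Ec.
  by congr (_ + _); [field; apply: nz | rewrite mulrA].
exists t => //; suff -> : t * F = j by [].
by apply/eqP; rewrite -tofrac_eq rmorphM /= EF Etj.
Qed.

End Localization.

Section IdealPowers.
Variables (R : comNzRingType) (I : set R).

Lemma ideal_expX a k : I a -> ideal_exp I k (a ^+ k).
Proof.
move=> Ia; elim: k => [//|k IHk]; rewrite exprS.
by apply: ideal_span_sub; exists a, (a ^+ k).
Qed.

Lemma ideal_exp_leq m k : (m <= k)%N -> ideal_exp I k `<=` ideal_exp I m.
Proof.
move=> /subnK <-; elim: (k - m)%N => // d IHd a; rewrite addSn => Ha.
apply: IHd; apply: ideal_span_min Ha; first exact: ideal_exp_ideal.
move=> _ [b [c [_ Hc ->]]].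
by have [_ _ H] := ideal_exp_ideal I (d + m); apply: H.
Qed.

End IdealPowers.

(* For the prime [p] of the elements at which [theta] has positive order,
   [p = (I : g)] is associated to [I]. *)
Lemma symbolic_power_ordge (R T : idomainType) (theta : {rmorphism R -> {poly T}})
    (I : set R) (g : R) m F :
  (forall a, (theta a)`_0 = 0 -> I (a * g)) ->
  (forall a, I a -> (theta a)`_0 = 0) -> (theta g)`_0 != 0 ->
  symbolic_power I m F -> ordge m (theta F).
Proof.
move=> Ig I0 g0; pose p : set R := [set a | (theta a)`_0 = 0].
have pr_p : is_prime_ideal p.
  split; [split | |]; rewrite /p /=.
  - by rewrite rmorph0 coef0.
  - by move=> a b Ha Hb; rewrite rmorphD coefD Ha Hb addr0.
  - by move=> a b Hb; rewrite rmorphM coef0M Hb mulr0.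
  - by rewrite rmorph1 coef1 => /eqP; rewrite oner_eq0.
  - move=> a b; rewrite rmorphM coef0M => /eqP; rewrite mulf_eq0.
    by case/orP => /eqP; [left | right].
have as_p : associated_primes I p.
  split=> //; exists g; apply/seteqP; split=> a /=; first exact: Ig.
  move=> /I0; rewrite rmorphM coef0M => /eqP; rewrite mulf_eq0 (negPf g0) orbF.
  by move/eqP.
move=> /(_ p as_p) /(local_ext_tofrac pr_p (ideal_exp_ideal I m)) [s ps HsF].
(* Elements of [I] have order at least 1, so those of its m-th power have order at least [m]; the
   multiplier [s] has order 0 and cancels. *)
have ord_exp a : ideal_exp I m a -> ordge m (theta a).
  elim: (m) a => [|k IHk] a; first by [].
  apply: (ideal_span_min (J := [set a | ordge k.+1 (theta a)])).
    split=> [|b c Hb Hc|b c Hc] /=.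
    - by rewrite rmorph0; apply: ordge0.
    - by rewrite rmorphD; apply: ordgeD.
    - by rewrite rmorphM; apply: ordgeMl.
  move=> _ [b [c [Ib /IHk Hc ->]]]; rewrite /= rmorphM -[k.+1]add1n.
  by apply: ordgeM => // -[|//] _; apply: I0.
apply: (@ordge_cancel _ m (theta s)); first exact/eqP.
by rewrite -rmorphM; apply: ord_exp.
Qed.

(** * The Fermat ideal localized at a prime *)

Section FermatRelations.
Variables (R : comNzRingType) (n : nat) (I : set R).
Hypothesis idI : is_ideal I.
Implicit Types x y z : R.

Definition fermat_gens x y z :=
  [/\ I (x * (y ^+ n - z ^+ n)), I (y * (z ^+ n - x ^+ n))
    & I (z * (x ^+ n - y ^+ n))].

Lemma fermat_gens_rot x y z : fermat_gens x y z -> fermat_gens y z x.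
Proof. by case. Qed.

Lemma fermat_gens_yz x y z :
  fermat_gens x y z -> I (y * z * (y ^+ n - z ^+ n)).
Proof.
case=> _ Hy Hz; have [_ ID IM] := idI.
rewrite (_ : _ * _ = - z * (y * (z ^+ n - x ^+ n)) + - y * (z * (x ^+ n - y ^+ n)));
  last by ring.
by apply: ID; apply: IM.
Qed.

Variable p : set R.
Hypotheses (pr_p : is_prime_ideal p) (Ip : I `<=` p).

Lemma fermat_prime_two x y z : (0 < n)%N -> fermat_gens x y z -> p x -> p y \/ p z.
Proof.
move=> n0 [_ /Ip Hy _] px; have [[_ pD pM] _ prp] := pr_p.
case: (prp _ _ Hy); first by left.
move=> pzx; right; apply: contrapT => /(prime_idealX (k := n) pr_p) [].
rewrite -(subrK (x ^+ n) (z ^+ n)); apply: pD => //.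
by case: (n) n0 => // k _; rewrite exprSr; apply: pM.
Qed.

(** Since w = z (y^n - z^n) is a unit at [p] and x w, y w lie in [I], both x and y are in [I]
    locally. Moreover w^n (x^n - y^n) = (x w)^n - (y w)^n puts x^n - y^n in the n-th power of [I].
    The multiplier is a power of w. *)
Lemma fermat_vertex x y z e1 e2 e3 a b c :
  (0 < n)%N -> fermat_gens x y z -> p y -> ~ p z ->
  exists2 s, ~ p s & ideal_exp I (e1 + e2 + n * c)
    (s * (x ^+ e1 * y ^+ e2 * z ^+ e3 *
      ((y ^+ n - z ^+ n) ^+ a * (z ^+ n - x ^+ n) ^+ b * (x ^+ n - y ^+ n) ^+ c))).
Proof.
move=> n0 gens py pz; have [[_ pD pM] _ prp] := pr_p.
set w := z * (y ^+ n - z ^+ n).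
have pw : ~ p w.
  case/prp => // pyz; apply: (prime_idealX (k := n) pr_p pz).
  rewrite -(subKr (y ^+ n) (z ^+ n)); apply: pD.
    by case: (n) n0 => // k _; rewrite exprSr; apply: pM.
  by rewrite -mulN1r; apply: pM.
exists (w ^+ (e1 + e2 + n * c)); first exact: prime_idealX.
have [_ ID IM] := idI.
have Ixw : I (x * w).
  by rewrite /w mulrCA; apply: IM; case: gens.
have Iyw : I (y * w) by rewrite /w mulrA; apply: (fermat_gens_yz gens).
have Ifw : ideal_exp I (n * c) ((w ^+ n * (x ^+ n - y ^+ n)) ^+ c).
  elim: c => [|c IHc]; first by rewrite muln0.
  rewrite mulnS exprS; apply: ideal_expD => //.
  have [_ ED EM] := ideal_exp_ideal I n.
  rewrite (_ : _ * _ = (x * w) ^+ n + - 1 * (y * w) ^+ n); last first.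
    by rewrite !exprMn; ring.
  by apply: ED; [|apply: EM]; apply: ideal_expX.
rewrite (_ : _ * _ = z ^+ e3 * ((y ^+ n - z ^+ n) ^+ a * (z ^+ n - x ^+ n) ^+ b) *
    ((x * w) ^+ e1 * (y * w) ^+ e2 * (w ^+ n * (x ^+ n - y ^+ n)) ^+ c)).
  have [_ _ EM] := ideal_exp_ideal I (e1 + e2 + n * c); apply: EM.
  by apply: ideal_expD Ifw; apply: ideal_expD; apply: ideal_expX.
by rewrite !exprD [w ^+ (n * c)]exprM !exprMn; ring.
Qed.

(** Here x, y, z are units at [p], so the three differences lie in [I] locally. *)
Lemma fermat_general x y z e1 e2 e3 a b c :
  fermat_gens x y z -> ~ p x -> ~ p y -> ~ p z ->
  exists2 s, ~ p s & ideal_exp I (a + b + c)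
    (s * (x ^+ e1 * y ^+ e2 * z ^+ e3 *
      ((y ^+ n - z ^+ n) ^+ a * (z ^+ n - x ^+ n) ^+ b * (x ^+ n - y ^+ n) ^+ c))).
Proof.
move=> [Ix Iy Iz] px py pz; have [_ _ prp] := pr_p.
exists (x ^+ a * y ^+ b * z ^+ c).
  by case/prp => [/prp[]|]; apply: (prime_idealX pr_p).
rewrite (_ : _ * _ = x ^+ e1 * y ^+ e2 * z ^+ e3 *
  ((x * (y ^+ n - z ^+ n)) ^+ a * (y * (z ^+ n - x ^+ n)) ^+ b *
   (z * (x ^+ n - y ^+ n)) ^+ c)); last by rewrite !exprMn; ring.
have [_ _ EM] := ideal_exp_ideal I (a + b + c); apply: EM.
by apply: ideal_expD; [apply: ideal_expD|]; apply: ideal_expX.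
Qed.

End FermatRelations.

Lemma ideal_span3 (A : comNzRingType) (a b c : A) (J := ideal_span [set` [:: a; b; c]]) :
  [/\ J a, J b & J c].
Proof. by split; apply: ideal_span_sub; rewrite /= !inE eqxx ?orbT. Qed.

Lemma ideal_span3_min (A : comNzRingType) (a b c : A) (J : set A) :
  is_ideal J -> J a -> J b -> J c -> ideal_span [set` [:: a; b; c]] `<=` J.
Proof.
move=> idJ Ja Jb Jc; apply: ideal_span_min => // f /=.
by rewrite !inE => /or3P[] /eqP ->.
Qed.

Lemma mulr_exp6D (A : comNzRingType) (x y z u v w : A) i j k a b c i' j' k' a' b' c' :
  x ^+ (i + i') * y ^+ (j + j') * z ^+ (k + k') *
    (u ^+ (a + a') * v ^+ (b + b') * w ^+ (c + c')) =
  x ^+ i * y ^+ j * z ^+ k * (u ^+ a * v ^+ b * w ^+ c) *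
    (x ^+ i' * y ^+ j' * z ^+ k' * (u ^+ a' * v ^+ b' * w ^+ c')).
Proof. by rewrite !exprD; ring. Qed.

Lemma mulr_exp3_weight (A : comNzRingType) (x y z t : A) i j k w0 w1 w2 :
  (x * t ^+ w0) ^+ i * (y * t ^+ w1) ^+ j * (z * t ^+ w2) ^+ k =
  x ^+ i * y ^+ j * z ^+ k * t ^+ (w0 * i + w1 * j + w2 * k).
Proof. by rewrite !exprMn !exprD !exprM; ring. Qed.

(** With the third factor written X - Y, the product is f2 (X f1) - f1 (Y f2), and X f1, Y f2 are
    multiples of generators. *)
Lemma fermat_gens_fff (A : comNzRingType) (I : set A) (x y z : A) n :
  (0 < n)%N -> is_ideal I -> fermat_gens n I x y z ->
  I ((y ^+ n - z ^+ n) * (z ^+ n - x ^+ n) * (x ^+ n - y ^+ n)).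
Proof.
move=> n_gt0 [_ ID IM] [Ix Iy _].
rewrite (_ : _ * _ = (z ^+ n - x ^+ n) * (x ^+ n * (y ^+ n - z ^+ n)) +
  - (y ^+ n - z ^+ n) * (y ^+ n * (z ^+ n - x ^+ n))); last by ring.
have E (u f : A) : I (u * f) -> I (u ^+ n * f).
  move=> If; have -> : u ^+ n = u ^+ n.-1 * u by rewrite -exprSr prednK.
  by rewrite -mulrA; apply: IM.
by apply: ID; apply: (IM); apply: E.
Qed.

Section FermatIdeal.
Context (K : fieldType) (n : nat).
Hypothesis n_gt0 : (0 < n)%N.
Local Notation R := {mpoly K[3]}.
Local Notation x := ('X_(inord 0) : R).
Local Notation y := ('X_(inord 1) : R).
Local Notation z := ('X_(inord 2) : R).
Local Notation I := (fermat_ideal K n).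

Lemma fermat_idealP : is_ideal I.
Proof. exact: ideal_span_ideal. Qed.

Lemma fermat_ideal_gens : fermat_gens n I x y z.
Proof. exact: ideal_span3. Qed.

Lemma fermat_ideal_sub (J : set R) :
  is_ideal J -> fermat_gens n J x y z -> I `<=` J.
Proof.
by move=> idJ [Jx Jy Jz]; exact: (ideal_span3_min idJ Jx Jy Jz).
Qed.

(** For m = 1 every admissible product is divisible by one of seven elements of [I]: x f1, y f2, z
    f3, y z f1, z x f2, x y f3, f1 f2 f3. *)
Lemma fermat_mon1_ideal e1 e2 e3 a b c :
  fermat_adm n 1 e1 e2 e3 a b c -> I (fermat_mon K n e1 e2 e3 a b c).
Proof.
have gx := fermat_ideal_gens; have gy := fermat_gens_rot gx.
have gz := fermat_gens_rot gy; have [Ix Iy Iz] := gx.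
have Iyz := fermat_gens_yz fermat_idealP gx.
have Izx := fermat_gens_yz fermat_idealP gy.
have Ixy := fermat_gens_yz fermat_idealP gz.
have [_ ID IM] := fermat_idealP.
have Ifff := fermat_gens_fff n_gt0 fermat_idealP gx.
have dvd e1' e2' e3' a' b' c' : I (fermat_mon K n e1' e2' e3' a' b' c') ->
    [&& e1' <= e1, e2' <= e2, e3' <= e3, a' <= a, b' <= b & c' <= c]%N ->
    I (fermat_mon K n e1 e2 e3 a b c).
  move=> IM' /and5P[l1 l2 l3 l4 /andP[l5 l6]].
  rewrite (_ : fermat_mon _ _ _ _ _ _ _ _ = fermat_mon K n (e1 - e1') (e2 - e2')
    (e3 - e3') (a - a') (b - b') (c - c') * fermat_mon K n e1' e2' e3' a' b' c').
    exact: IM.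
  by rewrite /fermat_mon -mulr_exp6D !subnK.
move=> adm.
have : [|| (0 < a) && (0 < e1), (0 < b) && (0 < e2), (0 < c) && (0 < e3),
    [&& 0 < a, 0 < e2 & 0 < e3], [&& 0 < b, 0 < e3 & 0 < e1],
    [&& 0 < c, 0 < e1 & 0 < e2] | [&& 0 < a, 0 < b & 0 < c]]%N.
  move: adm {dvd}; rewrite /fermat_adm.
  by case: a => [|a]; case: b => [|b]; case: c => [|c]; rewrite ?muln0; lia.
have mon e1' e2' e3' a' b' c' f : I f -> fermat_mon K n e1' e2' e3' a' b' c' = f ->
    [&& e1' <= e1, e2' <= e2, e3' <= e3, a' <= a, b' <= b & c' <= c]%N ->
    I (fermat_mon K n e1 e2 e3 a b c).
  by move=> If Ef; apply: dvd; rewrite Ef.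
case/orP => [lt|]; last case/orP => [lt|]; last case/orP => [lt|];
  last case/orP => [lt|]; last case/orP => [lt|]; last case/orP => [lt|lt].
- by apply: (mon 1 0 0 1 0 0 _ Ix)%N; [rewrite /fermat_mon; ring | lia].
- by apply: (mon 0 1 0 0 1 0 _ Iy)%N; [rewrite /fermat_mon; ring | lia].
- by apply: (mon 0 0 1 0 0 1 _ Iz)%N; [rewrite /fermat_mon; ring | lia].
- by apply: (mon 0 1 1 1 0 0 _ Iyz)%N; [rewrite /fermat_mon; ring | lia].
- by apply: (mon 1 0 1 0 1 0 _ Izx)%N; [rewrite /fermat_mon; ring | lia].
- by apply: (mon 1 1 0 0 0 1 _ Ixy)%N; [rewrite /fermat_mon; ring | lia].
- by apply: (mon 0 0 0 1 1 1 _ Ifff)%N; [rewrite /fermat_mon; ring | lia].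
Qed.

Lemma fermat_space1_ideal : fermat_space n 1 `<=` I.
Proof.
have [I0 ID IM] := fermat_idealP.
apply: kspan_min => //; first by move=> a f If; rewrite -mul_mpolyC; apply: IM.
by move=> _ [e1 [e2 [e3 [a [b [c [adm ->]]]]]]]; apply: fermat_mon1_ideal.
Qed.

Local Notation KR := ((polyC : {rmorphism R -> {poly R}}) \o
  (@mpolyC 3 K : {rmorphism K -> R})).

(** With weights 1, 1, 0 the order in ['X] is the (x, y)-adic order, that is, the order at (0 : 0 :
    1); the other coordinate points are similar. *)
Definition weight_chart w0 w1 w2 : {rmorphism R -> {poly R}} :=
  subst3 KR (x%:P * 'X^w0) (y%:P * 'X^w1) (z%:P * 'X^w2).

Lemma weight_chartX w0 w1 w2 (mm : 'X_{1..3}) :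
  weight_chart w0 w1 w2 'X_[mm] = ('X_[mm])%:P *
    'X^(w0 * mm (inord 0) + w1 * mm (inord 1) + w2 * mm (inord 2)).
Proof.
rewrite mpolyX3 [LHS]rmorphM [X in X * _]rmorphM !rmorphXn /= !subst3E.
by rewrite mulr_exp3_weight !rmorphM !rmorphXn.
Qed.

(** The variables are kept in the coefficients, so distinct monomials cannot cancel. *)
Lemma ordge_weight w0 w1 w2 m F mm :
  ordge m (weight_chart w0 w1 w2 F) -> mm \in msupp F ->
  (m <= w0 * mm (inord 0) + w1 * mm (inord 1) + w2 * mm (inord 2))%N.
Proof.
move=> ord mF; rewrite leqNgt; apply/negP => /ord /(congr1 (mcoeff mm)).
rewrite {1}(mpolyE F) rmorph_sum coef_sum mcoeff0 raddf_sum /=.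
rewrite (bigD1_seq mm) ?msupp_uniq //= big1 => [|mm' ne]; last first.
  rewrite /weight_chart subst3Z -/(weight_chart _ _ _) weight_chartX.
  rewrite /= coefCM coefCM mcoeffCM coefXn.
  by case: eqP => _; rewrite ?mulr1 ?mulr0 ?mcoeff0 ?mcoeffX ?(negPf ne) ?mulr0.
rewrite /weight_chart subst3Z -/(weight_chart _ _ _) weight_chartX.
rewrite /= coefCM coefCM mcoeffCM coefXn eqxx mulr1 mcoeffX eqxx mulr1 addr0.
by move/eqP; apply/negP; rewrite -mcoeff_msupp.
Qed.

(** The chart [point_chart] with z as scaling factor and y as direction: its coefficients lie in [R]
    itself, so that a constant term can be compared with the original form modulo an ideal. *)
Definition root_chart (al be : K) : {rmorphism R -> {poly R}} :=
  subst3 KR ((al *: z)%:P * (1 - 'X)) ((be *: z)%:P * (1 + y%:P * 'X)) z%:P.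

Lemma point_chartE al be F :
  point_chart al be F = map_poly (subst3
    ((polyC : {rmorphism {poly K} -> {poly {poly K}}}) \o
     (polyC : {rmorphism K -> {poly K}})) 0 'X%:P 'X) (root_chart al be F).
Proof.
move: F; apply: mpoly3_rect => [k||||p q Ep Eq|p q Ep Eq].
- by rewrite !subst3E /= map_polyC /= subst3C.
- rewrite !subst3E rmorphM rmorphB rmorph1 /= map_polyX map_polyC /= subst3E.
  by rewrite subst3z polyCM.
- rewrite !subst3E rmorphM rmorphD rmorphM rmorph1 /= map_polyX !map_polyC /=.
  by rewrite !subst3E polyCM.
- by rewrite !subst3E /= map_polyC /= subst3E.
- by rewrite !rmorphD Ep Eq.
- by rewrite !rmorphM Ep Eq.
Qed.

(** Modulo [J] each variable equals its constant term in the chart, and the constant term is a ring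
    morphism. *)
Lemma coef0_chart_ideal (theta : {rmorphism R -> {poly R}}) (J : set R) :
  is_ideal J -> (forall k, theta k%:MP = (k%:MP)%:P) ->
  J (x - (theta x)`_0) -> J (y - (theta y)`_0) -> J (z - (theta z)`_0) ->
  forall F, J (F - (theta F)`_0).
Proof.
move=> [J0 JD JM] thC Jx Jy Jz; apply: mpoly3_rect => // [k|p q Jp Jq|p q Jp Jq].
- by rewrite thC coefC eqxx subrr.
- by rewrite rmorphD coefD opprD addrACA; apply: JD.
rewrite rmorphM coef0M (_ : _ - _ =
  p * (q - (theta q)`_0) + (theta q)`_0 * (p - (theta p)`_0)); last by ring.
by apply: JD; apply: JM.
Qed.

End FermatIdeal.

Lemma coef0_morph_gen (A B : comNzRingType) (theta : {rmorphism A -> {poly B}}) n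
    (u v w : A) :
  (theta (u * (v ^+ n - w ^+ n)))`_0 =
  (theta u)`_0 * ((theta v)`_0 ^+ n - (theta w)`_0 ^+ n).
Proof.
by rewrite rmorphM rmorphB !rmorphXn -!horner_coef0 hornerM hornerD hornerN
  !horner_exp.
Qed.

Lemma coef0_morphMX (A B : comNzRingType) (theta : {rmorphism A -> {poly B}}) i j
    (u v : A) :
  (theta (u ^+ i * v ^+ j))`_0 = (theta u)`_0 ^+ i * (theta v)`_0 ^+ j.
Proof. by rewrite rmorphM !rmorphXn -!horner_coef0 hornerM !horner_exp. Qed.

Lemma mulr_subX0_neq0 (A : idomainType) (u : A) n :
  (0 < n)%N -> u != 0 -> u * (0 ^+ n - u ^+ n) != 0.
Proof.
move=> n0 u0; rewrite expr0n gtn_eqF // sub0r.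
by rewrite mulf_neq0 ?oppr_eq0 ?expf_neq0.
Qed.

(** The quotient of w^n - u^n by w - u. *)
Definition root_cofactor (A : comNzRingType) n (w u : A) :=
  \sum_(i < n) w ^+ (n.-1 - i) * u ^+ i.

Lemma root_cofactorE (A : comNzRingType) n (w u z : A) :
  u ^+ n = z ^+ n -> (w - u) * root_cofactor n w u = w ^+ n - z ^+ n.
Proof. by move=> <-; rewrite subrXX. Qed.

(** At w = u = v the cofactor takes the value n v^(n-1). *)
Lemma coef0_root_cofactor (A : comNzRingType) (B : idomainType)
    (theta : {rmorphism A -> {poly B}}) n (w u : A) (v : B) :
  (0 < n)%N -> n%:R != 0 :> B -> v != 0 ->
  (theta w)`_0 = v -> (theta u)`_0 = v -> (theta (root_cofactor n w u))`_0 != 0.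
Proof.
move=> n_gt0 n0 v0 Ew Eu; rewrite rmorph_sum coef_sum.
rewrite (eq_bigr (fun=> v ^+ n.-1)) => [|i _].
  by rewrite sumr_const card_ord -mulr_natr mulf_neq0 ?expf_neq0.
by rewrite coef0_morphMX Ew Eu -exprD subnK // -ltnS prednK.
Qed.

Lemma root_witness_ideal (A : comNzRingType) (I : set A) (x y z u v h k : A) n :
  is_ideal I -> fermat_gens n I x y z ->
  (x - u) * h = x ^+ n - z ^+ n -> (y - v) * k = y ^+ n - z ^+ n ->
  I ((x - u) * (x * y * z * (h * k))) /\ I ((y - v) * (x * y * z * (h * k))).
Proof.
move=> [_ _ IM] [Ix Iy _] Eh Ek; split.
  rewrite (_ : _ * _ = - (x * z * k) * (y * (z ^+ n - x ^+ n))); first exact: IM.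
  by rewrite -[z ^+ n - _]opprB -Eh; ring.
rewrite (_ : _ * _ = y * z * h * (x * (y ^+ n - z ^+ n))); first exact: IM.
by rewrite -Ek; ring.
Qed.

(** * Symbolic powers in the charts at the points *)

Section FermatSymbolic.
Context (K : fieldType) (n : nat).
Hypothesis n_gt0 : (0 < n)%N.
Local Notation R := {mpoly K[3]}.
Local Notation x := ('X_(inord 0) : R).
Local Notation y := ('X_(inord 1) : R).
Local Notation z := ('X_(inord 2) : R).
Local Notation I := (fermat_ideal K n).

Lemma mpolyU_neq0 (i : 'I_3) : 'X_i != 0 :> R.
Proof.
apply/eqP => /(congr1 (mcoeff U_(i))) /eqP.
by rewrite mcoeffX eqxx mcoeff0 oner_eq0.
Qed.

Definition chart_order (theta : {rmorphism R -> {poly R}}) :=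
  (forall m F, symbolic_power I m F -> ordge m (theta F)) /\
  (forall F, I F -> ordge 1 (theta F)).

(** The constant terms are the coordinates of a point of the configuration. The witness [g] does not
    vanish there, and the ideal of the point multiplies it into [I], so [symbolic_power_ordge]
    applies. *)
Lemma chart_orderP (theta : {rmorphism R -> {poly R}}) (x0 y0 z0 g : R) :
  (forall k, theta k%:MP = (k%:MP)%:P) ->
  (theta x)`_0 = x0 -> (theta y)`_0 = y0 -> (theta z)`_0 = z0 ->
  x0 * (y0 ^+ n - z0 ^+ n) = 0 -> y0 * (z0 ^+ n - x0 ^+ n) = 0 ->
  z0 * (x0 ^+ n - y0 ^+ n) = 0 ->
  I ((x - x0) * g) -> I ((y - y0) * g) -> I ((z - z0) * g) ->
  (theta g)`_0 != 0 -> chart_order theta.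
Proof.
move=> thC Ex Ey Ez Zx Zy Zz Ix Iy Iz g0.
have I0 a : I a -> (theta a)`_0 = 0.
  apply: (fermat_ideal_sub (J := [set a | (theta a)`_0 = 0])).
    split=> [|b c Hb Hc|b c Hc] /=.
    - by rewrite rmorph0 coef0.
    - by rewrite rmorphD coefD Hb Hc addr0.
    - by rewrite rmorphM coef0M Hc mulr0.
  by split; rewrite /= coef0_morph_gen Ex Ey Ez.
have [J0 JD JM] := fermat_idealP K n.
have Ig a : (theta a)`_0 = 0 -> I (a * g).
  move=> a0; rewrite -[a]subr0 -a0.
  apply: (coef0_chart_ideal (J := [set a | I (a * g)])); rewrite ?Ex ?Ey ?Ez //.
  split=> [|b c Hb Hc|b c Hc] /=; first by rewrite mul0r.
    by rewrite mulrDl; apply: JD.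
  by rewrite -mulrA; apply: JM.
split=> [m F|F IF]; first exact: symbolic_power_ordge Ig I0 g0.
by move=> [|//] _; apply: I0.
Qed.

Lemma weight_chartC w0 w1 w2 k : weight_chart K w0 w1 w2 k%:MP = (k%:MP)%:P.
Proof. by rewrite /weight_chart subst3C. Qed.

Lemma weight_chart_gens w0 w1 w2 :
  [/\ (weight_chart K w0 w1 w2 x)`_0 = (if w0 is 0 then x else 0),
      (weight_chart K w0 w1 w2 y)`_0 = (if w1 is 0 then y else 0)
    & (weight_chart K w0 w1 w2 z)`_0 = (if w2 is 0 then z else 0)].
Proof.
have E (a : R) w : (a%:P * 'X^w)`_0 = if w is 0 then a else 0.
  by rewrite coefCM coefXn; case: w => [|w]; rewrite ?mulr1 ?mulr0.
by rewrite /weight_chart !subst3E !E.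
Qed.

(** At (0 : 0 : 1) the witness is z (y^n - z^n), which x and y multiply into [I]. The next two
    lemmas rotate the variables. *)
Lemma weight_chart_order110 : chart_order (weight_chart K 1 1 0).
Proof.
have gx := fermat_ideal_gens K n; have [Ix Iy Iz] := gx.
have [I0 ID IM] := fermat_idealP K n.
have [Ex Ey Ez] : [/\ (weight_chart K 1 1 0 x)`_0 = 0,
    (weight_chart K 1 1 0 y)`_0 = 0 & (weight_chart K 1 1 0 z)`_0 = z].
  exact: weight_chart_gens.
move: (weight_chart K 1 1 0) (weight_chartC 1 1 0) Ex Ey Ez => theta thC Ex Ey Ez.
apply: (chart_orderP (g := z * (y ^+ n - z ^+ n)) thC Ex Ey Ez).
- by rewrite mul0r.
- by rewrite mul0r.
- by rewrite subrr mulr0.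
- by rewrite subr0 mulrCA; apply: IM.
- by rewrite subr0 mulrA; apply: (fermat_gens_yz (fermat_idealP K n) gx).
- by rewrite subrr mul0r; apply: I0.
by rewrite coef0_morph_gen Ez Ey mulr_subX0_neq0 ?mpolyU_neq0.
Qed.

Lemma weight_chart_order011 : chart_order (weight_chart K 0 1 1).
Proof.
have gx := fermat_gens_rot (fermat_ideal_gens K n); have [Ix Iy Iz] := gx.
have [I0 ID IM] := fermat_idealP K n.
have [Ex Ey Ez] : [/\ (weight_chart K 0 1 1 x)`_0 = x,
    (weight_chart K 0 1 1 y)`_0 = 0 & (weight_chart K 0 1 1 z)`_0 = 0].
  exact: weight_chart_gens.
move: (weight_chart K 0 1 1) (weight_chartC 0 1 1) Ex Ey Ez => theta thC Ex Ey Ez.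
apply: (chart_orderP (g := x * (z ^+ n - x ^+ n)) thC Ex Ey Ez).
- by rewrite subrr mulr0.
- by rewrite mul0r.
- by rewrite mul0r.
- by rewrite subrr mul0r; apply: I0.
- by rewrite subr0 mulrCA; apply: IM.
- by rewrite subr0 mulrA; apply: (fermat_gens_yz (fermat_idealP K n) gx).
by rewrite coef0_morph_gen Ex Ez mulr_subX0_neq0 ?mpolyU_neq0.
Qed.

Lemma weight_chart_order101 : chart_order (weight_chart K 1 0 1).
Proof.
have gx := fermat_gens_rot (fermat_gens_rot (fermat_ideal_gens K n)).
have [Ix Iy Iz] := gx.
have [I0 ID IM] := fermat_idealP K n.
have [Ex Ey Ez] : [/\ (weight_chart K 1 0 1 x)`_0 = 0,
    (weight_chart K 1 0 1 y)`_0 = y & (weight_chart K 1 0 1 z)`_0 = 0].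
  exact: weight_chart_gens.
move: (weight_chart K 1 0 1) (weight_chartC 1 0 1) Ex Ey Ez => theta thC Ex Ey Ez.
apply: (chart_orderP (g := y * (x ^+ n - y ^+ n)) thC Ex Ey Ez).
- by rewrite mul0r.
- by rewrite subrr mulr0.
- by rewrite mul0r.
- by rewrite subr0 mulrA; apply: (fermat_gens_yz (fermat_idealP K n) gx).
- by rewrite subrr mul0r; apply: I0.
- by rewrite subr0 mulrCA; apply: IM.
by rewrite coef0_morph_gen Ey Ex mulr_subX0_neq0 ?mpolyU_neq0.
Qed.

Lemma root_chart_gens al be :
  [/\ (root_chart al be x)`_0 = al *: z, (root_chart al be y)`_0 = be *: z
    & (root_chart al be z)`_0 = z].
Proof.
split.
- by rewrite /root_chart subst3x coefCM coefB coef1 coefX subr0 mulr1.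
- by rewrite /root_chart subst3y coefCM coefD coef1 coefCM coefX mulr0 addr0 mulr1.
- by rewrite /root_chart subst3z coefC.
Qed.

(** The witness is x y z times the cofactors of x - al z and y - be z in x^n - z^n and y^n - z^n. At
    the point these cofactors are nonzero because n is nonzero in [K]. *)
Lemma root_chart_order al be :
  n%:R != 0 :> K -> al ^+ n = 1 -> be ^+ n = 1 -> chart_order (root_chart al be).
Proof.
move=> n0 al1 be1; have [I0 _ _] := fermat_idealP K n.
have zE a : a ^+ n = 1 -> (a *: z) ^+ n = z ^+ n.
  by move=> a1; rewrite exprZn a1 scale1r.
have z0 : z != 0 by apply: mpolyU_neq0.
have nz a : a ^+ n = 1 -> a *: z != 0.
  move=> a1; rewrite scaler_eq0 (negPf z0) orbF; apply/eqP => a0.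
  by move/eqP: a1; rewrite a0 expr0n gtn_eqF // eq_sym oner_eq0.
have nR : n%:R != 0 :> R by rewrite -mpolyC_nat mpolyC_eq0.
have [Ex Ey Ez] := root_chart_gens al be.
have thC c : root_chart al be c%:MP = (c%:MP)%:P by rewrite /root_chart subst3C.
move: (root_chart al be) Ex Ey Ez thC => theta Ex Ey Ez thC.
have Ec c : (theta (c *: z))`_0 = c *: z.
  by rewrite -mul_mpolyC rmorphM coef0M thC coefC Ez.
have [] := root_witness_ideal (fermat_idealP K n) (fermat_ideal_gens K n)
  (root_cofactorE x (zE _ al1)) (root_cofactorE y (zE _ be1)).
have := coef0_root_cofactor n_gt0 nR (nz _ al1) Ex (Ec al).
have := coef0_root_cofactor n_gt0 nR (nz _ be1) Ey (Ec be).
move: (root_cofactor n x _) (root_cofactor n y _) => h k k0 h0 W1 W2.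
apply: (chart_orderP (g := x * y * z * (h * k)) thC Ex Ey Ez) => //.
- by rewrite (zE _ be1) subrr mulr0.
- by rewrite (zE _ al1) subrr mulr0.
- by rewrite (zE _ al1) (zE _ be1) subrr mulr0.
- by rewrite subrr mul0r.
rewrite !rmorphM !coef0M Ex Ey Ez.
by do !apply: mulf_neq0 => //; apply: nz.
Qed.

End FermatSymbolic.

Lemma mulr_rot3x2 (A : comNzRingType) (a b c u v w : A) :
  a * b * c * (u * v * w) = b * c * a * (v * w * u).
Proof. by ring. Qed.

Section FermatSymbolicPowers.
Context (K : fieldType) (n : nat).
Local Notation R := {mpoly K[3]}.
Local Notation x := ('X_(inord 0) : R).
Local Notation y := ('X_(inord 1) : R).
Local Notation z := ('X_(inord 2) : R).
Local Notation I := (fermat_ideal K n).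
Variable s : seq K.
Hypotheses (n_gt0 : (0 < n)%N) (n0 : n%:R != 0 :> K) (sz_s : size s = n)
  (us : uniq s) (s1 : forall a, a \in s -> a ^+ n = 1).

Lemma chart_fermat_space m F :
  ordge m (weight_chart K 1 1 0 F) -> ordge m (weight_chart K 0 1 1 F) ->
  ordge m (weight_chart K 1 0 1 F) ->
  (forall al be, al ^+ n = 1 -> be ^+ n = 1 -> ordge m (root_chart al be F)) ->
  fermat_space n m F.
Proof.
move=> H1 H2 H3 H4; apply: (fermat_spaceP n0 sz_s us s1) => [mm mF|al be al1 be1].
  have := ordge_weight H1 mF; have := ordge_weight H2 mF.
  by have := ordge_weight H3 mF; rewrite !mul1n !mul0n !addn0 => -> -> ->.
move=> k km; rewrite point_chartE coef_map (H4 _ _ al1 be1 _ km).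
exact: rmorph0.
Qed.

Lemma symbolic_fermat_space m F : symbolic_power I m F -> fermat_space n m F.
Proof.
move=> HF; apply: chart_fermat_space => [|||al be al1 be1].
- exact: (weight_chart_order110 K n_gt0).1.
- exact: (weight_chart_order011 K n_gt0).1.
- exact: (weight_chart_order101 K n_gt0).1.
- exact: (root_chart_order n_gt0 n0 al1 be1).1.
Qed.

Lemma ordge1_cancel (theta : {rmorphism R -> {poly R}}) (u v F : R) :
  chart_order n theta -> (theta u)`_0 = v -> v != 0 -> I (u * F) ->
  ordge 1 (theta F).
Proof.
move=> [_ H] Eu v0 IuF; apply: (@ordge_cancel _ 1 (theta u)); first by rewrite Eu.
by rewrite -rmorphM; apply: H.
Qed.

(** At each point of the configuration some variable is nonzero, so [F] has order at least 1 there
    and lies in [fermat_space n 1], hence in [I]. This keeps primes containing x, y and z from being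
    associated to [I]. *)
Lemma fermat_ideal_saturated F : I (x * F) -> I (y * F) -> I (z * F) -> I F.
Proof.
move=> IxF IyF IzF; apply: (fermat_space1_ideal n_gt0).
apply: chart_fermat_space => [|||al be al1 be1].
- have [_ _ E] := weight_chart_gens K 1 1 0.
  exact: (ordge1_cancel (weight_chart_order110 K n_gt0) E (mpolyU_neq0 _ _) IzF).
- have [E _ _] := weight_chart_gens K 0 1 1.
  exact: (ordge1_cancel (weight_chart_order011 K n_gt0) E (mpolyU_neq0 _ _) IxF).
- have [_ E _] := weight_chart_gens K 1 0 1.
  exact: (ordge1_cancel (weight_chart_order101 K n_gt0) E (mpolyU_neq0 _ _) IyF).
- have [_ _ E] := root_chart_gens al be.
  exact: (ordge1_cancel (root_chart_order n_gt0 n0 al1 be1) E (mpolyU_neq0 _ _) IzF).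
Qed.

Lemma fermat_mon_symbolic m e1 e2 e3 a b c :
  fermat_adm n m e1 e2 e3 a b c ->
  symbolic_power I m (fermat_mon K n e1 e2 e3 a b c).
Proof.
move=> /and4P[Hx Hy Hz Hp] p [pr_p [f Ep]] /=.
apply/(local_ext_tofrac pr_p (ideal_exp_ideal I m)).
have idI := fermat_idealP K n; have [_ _ IM] := idI.
have Ip : I `<=` p by move=> g Ig; rewrite Ep /= mulrC; apply: IM.
have gx := fermat_ideal_gens K n; have gy := fermat_gens_rot gx.
have gz := fermat_gens_rot gy.
have weaken k : (m <= k)%N ->
    (exists2 t, ~ p t & ideal_exp I k (t * fermat_mon K n e1 e2 e3 a b c)) ->
    exists2 t, ~ p t & ideal_exp I m (t * fermat_mon K n e1 e2 e3 a b c).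
  by move=> mk [t pt Ht]; exists t => //; apply: ideal_exp_leq Ht.
have two_x := fermat_prime_two pr_p Ip n_gt0 gx.
have two_y := fermat_prime_two pr_p Ip n_gt0 gy.
have two_z := fermat_prime_two pr_p Ip n_gt0 gz.
(* An associated prime cannot contain exactly one variable; it contains two (a coordinate point) or
   none, as saturation excludes three. *)
have [px|px] := pselect (p x); have [py|py] := pselect (p y);
  have [pz|pz] := pselect (p z).
- exfalso; have [_ p1 _] := pr_p; apply: p1; rewrite Ep /= mul1r.
  by move: px py pz; rewrite Ep /=; apply: fermat_ideal_saturated.
- apply: (weaken _ Hz).
  exact: (fermat_vertex idI pr_p e1 e2 e3 a b c n_gt0 gx py pz).
- apply: (weaken (e3 + e1 + n * b)%N); first by rewrite (addnC e3).
  have [t pt Ht] := fermat_vertex idI pr_p e3 e1 e2 c a b n_gt0 gz px py.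
  by exists t => //; rewrite /fermat_mon 2!mulr_rot3x2.
- by case: (two_x px).
- apply: (weaken _ Hx).
  have [t pt Ht] := fermat_vertex idI pr_p e2 e3 e1 b c a n_gt0 gy pz px.
  by exists t => //; rewrite /fermat_mon mulr_rot3x2.
- by case: (two_y py).
- by case: (two_z pz).
- apply: (weaken _ Hp).
  exact: (fermat_general pr_p e1 e2 e3 a b c gx px py pz).
Qed.

Lemma symbolic_powerE m : symbolic_power I m = fermat_space n m.
Proof.
apply/seteqP; split; first exact: symbolic_fermat_space.
have [S0 SD SM] := symbolic_power_ideal I m.
apply: kspan_min => //; first by move=> k F HF; rewrite -mul_mpolyC; apply: SM.
by move=> _ [e1 [e2 [e3 [a [b [c [adm ->]]]]]]]; apply: fermat_mon_symbolic.
Qed.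

End FermatSymbolicPowers.

Lemma polyC_mul6 (A : comNzRingType) (x y z u v w : A) (t : {poly A}) i j k a b c :
  x%:P ^+ i * (y%:P ^+ j * (z%:P ^+ k * (u%:P ^+ a * (v%:P ^+ b * (w%:P ^+ c * t))))) =
  (x ^+ i * y ^+ j * z ^+ k * (u ^+ a * v ^+ b * w ^+ c))%:P * t.
Proof. by rewrite !rmorphM !rmorphXn /= !mulrA. Qed.

(** * The symbolic Rees algebra *)

Section MonomialProjection.
Context (K : fieldType) (N : nat) (D : pred 'X_{1..N}).
Hypothesis DD : forall m m', D m' -> D (m + m')%MM = D m.
Implicit Types p q : {mpoly K[N]}.

Definition mproj p : {mpoly K[N]} :=
  \sum_(m <- msupp p | D m) p@_m *: 'X_[m].

Definition mproj_fixed : set {mpoly K[N]} := [set p | {subset msupp p <= D}].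

Lemma mcoeff_mproj p m : (mproj p)@_m = if D m then p@_m else 0.
Proof.
rewrite /mproj raddf_sum /=.
under eq_bigr => m' _ do rewrite mcoeffZ mcoeffX.
have [mp|mp] := boolP (m \in msupp p); last first.
  rewrite (memN_msupp_eq0 mp) if_same big_seq_cond big1 // => m' /andP[m'p _].
  by case: eqP m'p mp => [-> ->|]; rewrite ?mulr0.
rewrite big_mkcond (bigD1_seq m) ?msupp_uniq //= eqxx mulr1 big1 ?addr0 //.
by move=> m' /negPf ->; rewrite mulr0 if_same.
Qed.

Lemma mprojD p q : mproj (p + q) = mproj p + mproj q.
Proof.
apply/mpolyP => m; rewrite mcoeffD !mcoeff_mproj mcoeffD.
by case: ifP; rewrite ?addr0.
Qed.

Lemma mprojZ c p : mproj (c *: p) = c *: mproj p.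
Proof.
apply/mpolyP => m; rewrite mcoeffZ !mcoeff_mproj mcoeffZ.
by case: ifP; rewrite ?mulr0.
Qed.

Lemma mprojX m : mproj 'X_[m] = if D m then 'X_[m] else 0.
Proof.
apply/mpolyP => m'; rewrite mcoeff_mproj (fun_if (mcoeff m')) mcoeffX mcoeff0.
by case: eqP => [->|_]; rewrite ?if_same.
Qed.

Lemma mproj_sum (T : Type) (r : seq T) (F : T -> {mpoly K[N]}) :
  mproj (\sum_(i <- r) F i) = \sum_(i <- r) mproj (F i).
Proof.
apply: (big_morph mproj mprojD).
by apply/mpolyP => m; rewrite mcoeff_mproj mcoeff0 if_same.
Qed.

Lemma mproj_fixed_mproj p : mproj_fixed (mproj p).
Proof.
move=> m; rewrite mcoeff_msupp mcoeff_mproj unfold_in.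
by case: (D m); rewrite ?eqxx.
Qed.

Lemma mproj_id p : mproj_fixed p -> mproj p = p.
Proof.
move=> Dp; apply/mpolyP => m; rewrite mcoeff_mproj.
case: ifPn => // Dm; rewrite memN_msupp_eq0 //.
by apply/negP => /Dp; apply/negP.
Qed.

(** Multiplying by a monomial in [D] neither creates nor destroys membership in [D], as with the
    degree 0 part of a graded ring. *)
Lemma mproj_mull q p : mproj_fixed p -> mproj (q * p) = mproj q * p.
Proof.
move=> Dp; rewrite {1}(mpolyE p) mulr_sumr mproj_sum [X in _ = _ * X]mpolyE mulr_sumr.
rewrite big_seq [RHS]big_seq; apply: eq_bigr => m' /Dp Dm'.
rewrite -!scalerAr mprojZ; congr (_ *: _).
rewrite {1}(mpolyE q) mulr_suml mproj_sum [mproj q]/mproj.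
rewrite [X in _ = X * _]big_mkcond mulr_suml.
apply: eq_bigr => m _; rewrite -scalerAl -mpolyXD mprojZ mprojX DD //.
by case: (D m); rewrite ?mul0r ?scaler0 // mpolyXD scalerAl.
Qed.

Lemma mproj_fixedD p q : mproj_fixed p -> mproj_fixed q -> mproj_fixed (p + q).
Proof. by move=> Hp Hq m /msuppD_le; rewrite mem_cat => /orP[/Hp|/Hq]. Qed.

Lemma mproj_fixedZ c p : mproj_fixed p -> mproj_fixed (c *: p).
Proof. by move=> Hp m /msuppZ_le; apply: Hp. Qed.

Lemma mproj_fixed0 : mproj_fixed 0.
Proof. by move=> m; rewrite msupp0. Qed.

Lemma mproj_fixedX m : D m -> mproj_fixed 'X_[m].
Proof. by move=> Dm m'; rewrite msuppX inE => /eqP ->. Qed.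

End MonomialProjection.

Section FermatPresentation.
Context (K : fieldType) (n : nat).
Local Notation R := {mpoly K[3]}.
Local Notation x := ('X_(inord 0) : R).
Local Notation y := ('X_(inord 1) : R).
Local Notation z := ('X_(inord 2) : R).

(* The last four variables, which are sent to 1, turn the inequalities of
   [fermat_adm] into the equations of [slack_eq]. *)
Definition slack_eq (mm : 'X_{1..11}) :=
  let d k := mm (inord k) in
  [&& d 1 + d 2 + n * d 3 == d 6 + d 7, d 0 + d 2 + n * d 4 == d 6 + d 8,
      d 0 + d 1 + n * d 5 == d 6 + d 9 & d 3 + d 4 + d 5 == d 6 + d 10]%N.

Definition presentation_gens : seq {poly R} :=
  [:: x%:P; y%:P; z%:P; (y ^+ n - z ^+ n)%:P; (z ^+ n - x ^+ n)%:P;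
      (x ^+ n - y ^+ n)%:P; 'X; 1; 1; 1; 1].

Definition presentation : {rmorphism {mpoly K[11]} -> {poly R}} :=
  mmap ((polyC : {rmorphism R -> {poly R}}) \o
        (@mpolyC 3 K : {rmorphism K -> R}))
    (fun i : 'I_11 => presentation_gens`_i).

Lemma slack_eqD m m' : slack_eq m' -> slack_eq (m + m')%MM = slack_eq m.
Proof.
rewrite /slack_eq /= !mnmDE => /and4P[/eqP E1 /eqP E2 /eqP E3 /eqP E4].
by congr [&& _, _, _ & _]; rewrite ?mulnDr; apply/eqP/eqP; lia.
Qed.

Lemma presentationX mm :
  presentation 'X_[mm] = (fermat_mon K n (mm (inord 0)) (mm (inord 1))
    (mm (inord 2)) (mm (inord 3)) (mm (inord 4)) (mm (inord 5)))%:P *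
    'X^(mm (inord 6)).
Proof.
rewrite /presentation /= mmapX /mmap1.
under eq_bigr => i _ do rewrite -{2}(inord_val i).
rewrite -(big_mkord predT (fun i => presentation_gens`_i ^+ mm (inord i))).
rewrite /index_iota /= !big_cons big_nil /= !expr1n !mulr1.
exact: polyC_mul6.
Qed.

Lemma presentationZ c p : presentation (c *: p) = (c%:MP)%:P * presentation p.
Proof. by rewrite /presentation /= mmapZ. Qed.

Lemma fermat_space_presentation m F :
  fermat_space n m F ->
  exists2 p, mproj_fixed slack_eq p & presentation p = F%:P * 'X^m.
Proof.
have := presentationX; have := presentationZ.
move: presentation => phi phiZ phiX.
apply: (kspan_min (T := [set F | exists2 p,
  mproj_fixed slack_eq p & phi p = F%:P * 'X^m])) => /=.
- by exists 0; [apply: mproj_fixed0 | rewrite rmorph0 mul0r].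
- move=> f g [p Dp Ep] [q Dq Eq]; exists (p + q); first exact: mproj_fixedD.
  by rewrite rmorphD Ep Eq polyCD mulrDl.
- move=> k f [p Dp Ep]; exists (k *: p); first exact: mproj_fixedZ.
  by rewrite phiZ Ep -mul_mpolyC polyCM mulrA.
move=> _ [e1 [e2 [e3 [a [b [c [adm ->]]]]]]] /=.
(* The last four exponents are the slacks of the four inequalities. *)
pose l := [:: e1; e2; e3; a; b; c; m; e2 + e3 + n * a - m; e1 + e3 + n * b - m;
  e1 + e2 + n * c - m; a + b + c - m]%N.
pose mm := [multinom nth 0%N l (i : 'I_11) | i < 11].
have mmE k : (k < 11)%N -> mm (inord k) = nth 0%N l k by move=> lt; rewrite mnmE inordK.
exists 'X_[mm]; last by rewrite phiX !mmE.
apply: mproj_fixedX; rewrite /slack_eq /= !mmE //=.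
by move: adm => /and4P[H1 H2 H3 H4]; rewrite !subnKC ?eqxx.
Qed.

Hypothesis symE : forall m, symbolic_power (fermat_ideal K n) m = fermat_space n m.

Lemma presentation_symbolic p :
  mproj_fixed slack_eq p ->
  forall i, symbolic_power (fermat_ideal K n) i (presentation p)`_i.
Proof.
move=> Dp i; have idS := symbolic_power_ideal (fermat_ideal K n) i.
rewrite (mpolyE p) rmorph_sum coef_sum; apply: ideal_sum => // mm /Dp Dmm _.
have [S0 _ SM] := idS.
rewrite presentationZ presentationX coefCM coefCM coefXn; apply: (SM).
case: eqP => [->|_]; last by rewrite mulr0.
rewrite mulr1 symE; apply: kspan_sub; do 6!eexists; split; last by [].
move: Dmm; rewrite /slack_eq unfold_in /= => /and4P[/eqP H1 /eqP H2 /eqP H3 /eqP H4].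
by rewrite /fermat_adm H1 H2 H3 H4 !leq_addr.
Qed.

Lemma presentation_onto (P : {poly {mpoly K[3]}}) :
  (forall i, symbolic_power (fermat_ideal K n) i P`_i) ->
  exists2 p, mproj_fixed slack_eq p & presentation p = P.
Proof.
move=> HP; rewrite -[P]coefK poly_def.
have H i : exists2 p, mproj_fixed slack_eq p & presentation p = P`_i *: 'X^i.
  have := HP i; rewrite symE => /fermat_space_presentation[p Dp Ep].
  by exists p => //; rewrite Ep mul_polyC.
move: presentation H => phi H.
apply: (big_ind (fun P => exists2 p, mproj_fixed slack_eq p & phi p = P)) =>
  [|f g [p Dp Ep] [q Dq Eq]|i _].
- by exists 0; [apply: mproj_fixed0 | rewrite rmorph0].
- by exists (p + q); [apply: mproj_fixedD | rewrite rmorphD Ep Eq].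
- exact: H.
Qed.

Lemma noetherian_symbolic_rees :
  noetherian (symbolic_rees (fermat_ideal K n)).
Proof.
apply: (@noetherian_retract {mpoly K[11]} {poly R} _ (mproj_fixed slack_eq)
  (mproj slack_eq) presentation
  (\val : {rmorphism symbolic_rees (fermat_ideal K n) -> {poly R}})).
- exact: noetherian_mpoly.
- exact: val_inj.
- exact: mproj_fixed_mproj.
- exact: mprojD.
- by move=> q p Dp; apply: (mproj_mull slack_eqD).
- by move=> p; apply: mproj_id.
- move=> p Dp; have Hp : presentation p \in symbolic_rees_pred (fermat_ideal K n).
    exact/asboolP/presentation_symbolic.
  by exists (SymbolicRees Hp).
- move=> [P HP]; have [|p Dp Ep] := presentation_onto (P := P).
    by apply/asboolP; exact: HP.
  by exists p.
Qed.

End FermatPresentation.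

Theorem theorem4p3 (n : nat) (K : fieldType) (hn : (2 <= n)%N)
    (hK : exists s : seq K, [/\ size s = n, uniq s & all n.-unity_root s]) :
  noetherian (symbolic_rees (fermat_ideal K n)).
Proof.
have [s [sz us /allP s1]] := hK; have n_gt0 : (0 < n)%N := ltnW hn.
(* Having n distinct n-th roots of 1, [K] contains a primitive one, so its characteristic does not
   divide n. *)
have n0 : n%:R != 0 :> K.
  have [|w _] := hasP (has_prim_root n_gt0 (introT allP s1) us _).
    by rewrite sz.
  exact: prim_root_natf_neq0.
apply: noetherian_symbolic_rees => m.
by apply: (symbolic_powerE n_gt0 n0 sz us) => a /s1 /unity_rootP.
Qed.
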